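(* Let $p$ be an odd prime and let $\mathcal O$ be a complete discrete valuation ring with maximal ideal generated by $p$ and perfect residue field, with its unique $p$-derivation $\delta$. Let $G=GL_2$ over $\mathcal O$, let $d_1,d_2\in\mathcal O^\times$, $q_1=d_1\cdot 1_2$, $q_2=d_2\cdot 1_2\in G(\mathcal O)$, and let $(\delta_1^G,\delta_2^G)$ be the Levi-Civita connection on $G$ over $\mathcal O$ attached to $(q_1,q_2)$. Let $G'=GL_1^c\subset G$ and $G''=U_1^c\subset G'$. Then: 1) $G'$ is $\delta_i^G$-horizontal for $i=1,2$. 2) $G''$ is $\delta_i^G$-horizontal for $i=1,2$ if and only if $\delta d_1=\delta d_2=0$. 3) Assume $d_1=d_2=:d\in\mathbb Z$, $d\ne\pm1$, $d\not\equiv 0$ mod $p$. Then there is no closed connected proper subgroup scheme of $G'$ that is $\delta_i^G$-horizontal for $i=1,2$.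
   Context: For a matrix $a=(a_{ij})$, $a^t$ is the transpose and $a^{(p)}=(a_{ij}^p)$; set maps between rings are applied to matrices entrywise. A Frobenius lift on a ring $A$ is a ring endomorphism reducing mod $p$ to the $p$-power Frobenius of $A/pA$. On a $p$-torsion free ring a $p$-derivation $\delta$ is the same as a Frobenius lift $\phi$, via $\phi(a)=a^p+p\,\delta a$ (''attached'' to each other). $\widehat{\ }$ is $p$-adic completion. $\mathcal O$ has a unique Frobenius lift $\phi$, hence a unique $p$-derivation $\delta$. Let $x$ be an $n\times n$ matrix of indeterminates (here $n=2$), $G=GL_n=\mathrm{Spec}\,\mathcal O[x,\det(x)^{-1}]$, $\mathcal O(\widehat G)=\mathcal O[x,\det(x)^{-1}]^{\widehat{\ }}$. A $p$-adic connection on $G$ is a $p$-derivation $\delta^G$ on $\mathcal O(\widehat G)$ extending $\delta$; its attached Frobenius lift is $\phi^G$. The trivial one has Frobenius lift $\phi_0^G$ with $\phi_0^G(x)=x^{(p)}$. For a symmetric $q\in GL_n(\mathcal O)$, let $\mathcal H_q:\mathcal O(\widehat G)\to\mathcal O(\widehat G)$ be the (continuous) $\mathcal O$-algebra map with $\mathcal H_q(x)=x^tqx$; $\delta^G$ is metric with respect to $q$ if $\phi^G\circ\mathcal H_q=\mathcal H_q\circ\phi_0^G$ as ring endomorphisms of $\mathcal O(\widehat G)$. Levi-Civita connection attached to symmetric $q_1,\dots,q_n\in GL_n(\mathcal O)$: the unique (it exists and is unique) $n$-tuple $(\delta_1^G,\dots,\delta_n^G)$ of $p$-adic connections on $G$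 such that each $\delta_i^G$ is metric with respect to $q_i$ and such that, with $\Gamma_i=(\Gamma_{ijk})_{j,k}:=(\delta_i^Gx)^t\cdot\phi(q_i)\cdot x^{(p)}$, one has $\Gamma_{ijk}=\Gamma_{jik}$ for all $i,j,k$. A closed subscheme $Y\subset G$ is $\delta^G$-horizontal if the ideal of $\mathcal O(\widehat G)$ defining $\widehat Y$ in $\widehat G$ is sent into itself by $\delta^G$. $G'=GL_1^c$ is the centralizer in $GL_2$ of $c=\begin{pmatrix}0&1\\-1&0\end{pmatrix}$; i.e. $G'=\mathrm{Spec}\,\mathcal O[\alpha,\beta,(\alpha^2+\beta^2)^{-1}]$ embedded in $G$ via $x\mapsto\begin{pmatrix}\alpha&\beta\\-\beta&\alpha\end{pmatrix}$. $G''=U_1^c=\mathrm{Spec}\,\mathcal O[\alpha,\beta]/(\alpha^2+\beta^2-1)$ is the kernel of $\det:G'\to GL_1$. *)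

(* Defs.v *)
From HB Require Import structures.
From mathcomp Require Import all_boot all_order all_algebra.
From mathcomp Require Import boolp classical_sets functions.
From mathcomp Require Import mpoly.

Set Implicit Arguments.
Unset Strict Implicit.
Unset Printing Implicit Defensive.

Import GRing.Theory.
Local Open Scope classical_set_scope.
Local Open Scope ring_scope.
Local Open Scope quotient_scope.

Section Ideals.
Variable R : comPzRingType.

(* Unlike the library's [idealr], the unit ideal is allowed. *)
Definition is_ideal (J : set R) : Prop :=
  [/\ J 0, forall a b, J a -> J b -> J (a + b) & forall a b, J b -> J (a * b)].

Definition ideal_gen (S : set R) : set R := smallest is_ideal S.

Definition is_prime_ideal (P : set R) : Prop :=
  [/\ is_ideal P, ~ P 1 & forall a b, P (a * b) -> P a \/ P b].

(* The topological space Spec (R / J) = V(J) is connected: it is nonempty, and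
   if it is the disjoint union of two closed subsets (cut out by E1 and E2),
   then one of them is everything. *)
Definition spec_quotient_connected (J : set R) : Prop :=
  let X := [set P | is_prime_ideal P /\ J `<=` P] in
  let V (E : set R) := [set P | X P /\ E `<=` P] in
  X !=set0 /\
  forall E1 E2 : set R,
    V E1 `|` V E2 = X -> V E1 `&` V E2 = set0 -> V E1 = X \/ V E2 = X.

End Ideals.

Definition pdivides (p : nat) (R : comPzRingType) (m : nat) : set R :=
  [set a | exists b, a = p%:R ^+ m * b].

(* Separated and Cauchy complete for the p-adic topology. *)
Definition padically_complete (p : nat) (R : comPzRingType) : Prop :=
  (forall a : R, (forall m, pdivides p m a) -> a = 0) /\
  (forall u : nat -> R, (forall m, pdivides p m (u m.+1 - u m)) ->
    exists l, forall m, pdivides p m (l - u m)).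

(* A complete discrete valuation ring with maximal ideal (p) and perfect residue
   field: a local principal ideal domain, not a field (as p <> 0), whose set of
   nonunits is pO.  The residue field O/pO has characteristic p, so it is
   perfect iff its Frobenius is surjective. *)
Record complete_dvr (p : nat) (O : idomainType) : Prop := CompleteDVR {
  cdvr_principal : forall J : set O, is_ideal J ->
    exists a, J = [set a * b | b in [set: O]];
  cdvr_nonunits : forall a : O, a \isn't a GRing.unit <-> pdivides p 1 a;
  cdvr_unif_neq0 : p%:R != 0 :> O;
  cdvr_complete : padically_complete p O;
  cdvr_perfect : forall a : O, exists b, pdivides p 1 (a - b ^+ p)
}.

(* The p-adic completion lim_m R / p^m R, realized as the ring of coherent
   sequences u (u m representing a class modulo p^m) modulo those with
   u m = 0 mod p^m for all m.  [R] is arbitrary, so 1 = 0 may hold here. *)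
Section Completion.
Variables (p : nat) (R : comPzRingType).

Definition coherent_pred : {pred nat -> R} :=
  fun u => `[< forall m, pdivides p m (u m.+1 - u m) >].

Lemma coherent_subring : subring_closed coherent_pred.
Proof.
split=> [|u v /asboolP hu /asboolP hv|u v /asboolP hu /asboolP hv];
  apply/asboolP => m.
- by exists 0; rewrite mulr0 subrr.
- have [a ha] := hu m; have [b hb] := hv m; exists (a - b).
  rewrite -[(u - v) m.+1]/(u m.+1 - v m.+1) -[(u - v) m]/(u m - v m).
  by rewrite mulrBr -ha -hb opprD addrACA -opprD.
- have [a ha] := hu m; have [b hb] := hv m.
  exists (u m.+1 * b + a * v m).
  rewrite -[(u * v) m.+1]/(u m.+1 * v m.+1) -[(u * v) m]/(u m * v m).
  rewrite mulrDr mulrCA -hb mulrA -ha mulrBr mulrBl addrA.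
  by rewrite addrNK.
Qed.

HB.instance Definition _ :=
  GRing.isSubringClosed.Build (nat -> R) coherent_pred coherent_subring.

Record coherent := Coherent
  { coherent_val :> nat -> R; _ : coherent_val \in coherent_pred }.
HB.instance Definition _ := [isSub for coherent_val].
HB.instance Definition _ := [Choice of coherent by <:].
HB.instance Definition _ := GRing.SubChoice_isSubComPzRing.Build (nat -> R)
  coherent_pred coherent coherent_subring.

Definition null_pred : {pred coherent} :=
  fun u => `[< forall m, pdivides p m (u m) >].

Lemma null_zmod : zmod_closed null_pred.
Proof.
split=> [|u v /asboolP hu /asboolP hv]; apply/asboolP => m.
  by exists 0; rewrite mulr0.
have [a ha] := hu m; have [b hb] := hv m; exists (a - b).
by rewrite mulrBr -ha -hb.
Qed.

HB.instance Definition _ :=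
  GRing.isZmodClosed.Build coherent null_pred null_zmod.

Lemma null_mull u v : v \in null_pred -> u * v \in null_pred.
Proof.
move=> /asboolP hv; apply/asboolP => m; have [b hb] := hv m.
by exists (u m * b); rewrite mulrCA -hb.
Qed.

Definition completion := @Quotient.quot coherent null_pred.
HB.instance Definition _ := ZmodQuotient.on completion.

Definition completion_one : completion := lift_cst completion 1.
Definition completion_mul := lift_op2 completion *%R.

Canonical pi_completion_one := PiConst completion_one.

Lemma pi_completion_mulP :
  {morph \pi_completion : u v / u * v >-> completion_mul u v}.
Proof.
move=> u v; unlock completion_mul; apply/eqP.
rewrite -Quotient.idealrBE.
rewrite -[u * v](addrNK (u * repr (\pi_completion v))) -mulrBr -addrA -mulrBl.
apply: rpredD; last rewrite mulrC; apply: null_mull.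
  by rewrite Quotient.idealrBE reprK.
by rewrite Quotient.idealrBE reprK.
Qed.
Canonical pi_completion_mul := PiMorph2 pi_completion_mulP.

Lemma completion_mulA : associative completion_mul.
Proof. by move=> x y z; rewrite -[x]reprK -[y]reprK -[z]reprK !piE mulrA. Qed.

Lemma completion_mulC : commutative completion_mul.
Proof. by move=> x y; rewrite -[x]reprK -[y]reprK !piE mulrC. Qed.

Lemma completion_mul1 : left_id completion_one completion_mul.
Proof. by move=> x; rewrite -[x]reprK !piE mul1r. Qed.

Lemma completion_mulDl : left_distributive completion_mul +%R.
Proof.
move=> x y z; rewrite -[x]reprK -[y]reprK -[z]reprK.
by rewrite !piE mulrDl.
Qed.

HB.instance Definition _ := GRing.Zmodule_isComPzRing.Build completion
  completion_mulA completion_mulC completion_mul1 completion_mulDl.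

Lemma const_coherent (a : R) : (fun=> a) \in coherent_pred.
Proof. by apply/asboolP => m; exists 0; rewrite mulr0 subrr. Qed.

Definition to_completion (a : R) : completion :=
  \pi_completion (Coherent (const_coherent a)).

Lemma to_completion_zmod : zmod_morphism to_completion.
Proof.
move=> a b; rewrite /to_completion.
rewrite -[- \pi _]pi_oppr -[RHS]pi_addr; congr (\pi_completion _).
exact: val_inj.
Qed.

Lemma to_completion_monoid : monoid_morphism to_completion.
Proof.
split=> [|a b]; rewrite /to_completion.
  have -> : (1 : completion) = \pi_completion 1 by rewrite piE.
  by congr (\pi_completion _); exact: val_inj.
rewrite -[RHS]pi_completion_mulP; congr (\pi_completion _).
exact: val_inj.
Qed.

HB.instance Definition _ :=
  GRing.isZmodMorphism.Build R completion to_completion to_completion_zmod.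
HB.instance Definition _ :=
  GRing.isMonoidMorphism.Build R completion to_completion to_completion_monoid.

End Completion.

Arguments to_completion p {R} a.

(* The coordinate ring O[x, det(x)^-1] of GL_n over O, inside the fraction field
   of the polynomial ring O[x] in n * n indeterminates. *)
Section CoordGL.
Variables (O : idomainType) (n : nat).

Definition poly_x : 'M[{mpoly O[n * n]}]_n :=
  \matrix_(i, j) 'X_(mxvec_index i j).

Definition coordGL_pred : {pred {fraction {mpoly O[n * n]}}} :=
  fun f => `[< exists g k, f = tofrac g / tofrac (\det poly_x) ^+ k >].

Lemma det_poly_x_neq0 : \det poly_x != 0.
Proof.
pose v (k : 'I_(n * n)) : O := mxvec (1%:M : 'M_n) 0 k.
apply/eqP => /(congr1 (meval v)); rewrite -det_map_mx meval0.
suff -> : map_mx (meval v) poly_x = 1%:M by rewrite det1; apply/eqP/oner_neq0.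
by apply/matrixP => i j; rewrite !mxE mevalXU /v mxvecE mxE.
Qed.

Lemma coordGL_subring : subring_closed coordGL_pred.
Proof.
have D0 k : tofrac (\det poly_x) ^+ k != 0.
  by rewrite expf_neq0 // tofrac_eq0 det_poly_x_neq0.
split=> [|_ _ /asboolP[f [k ->]] /asboolP[g [l ->]]
  |_ _ /asboolP[f [k ->]] /asboolP[g [l ->]]]; apply/asboolP.
- by exists 1, 0; rewrite rmorph1 expr0 divr1.
- exists (f * \det poly_x ^+ l - g * \det poly_x ^+ k), (k + l)%N.
  rewrite rmorphB !rmorphM !rmorphXn mulrBl exprD -!mulrA; congr (_ * _ - _ * _).
    by rewrite invfM mulrCA mulfV ?mulr1.
  by rewrite invfM mulVKf.
- by exists (f * g), (k + l)%N; rewrite rmorphM exprD invfM mulrACA.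
Qed.

HB.instance Definition _ :=
  GRing.isSubringClosed.Build _ coordGL_pred coordGL_subring.

Record coordGL := CoordGL {
  coordGL_val :> {fraction {mpoly O[n * n]}};
  _ : coordGL_val \in coordGL_pred }.
HB.instance Definition _ := [isSub for coordGL_val].
HB.instance Definition _ := [Choice of coordGL by <:].
HB.instance Definition _ := [SubChoice_isSubComNzRing of coordGL by <:].

Lemma poly_coordGL (g : {mpoly O[n * n]}) : tofrac g \in coordGL_pred.
Proof. by apply/asboolP; exists g, 0; rewrite expr0 divr1. Qed.

Definition coordGL_poly (g : {mpoly O[n * n]}) : coordGL :=
  CoordGL (poly_coordGL g).

Lemma coordGL_poly_zmod : zmod_morphism coordGL_poly.
Proof. by move=> g h; apply: val_inj; exact: rmorphB. Qed.

Lemma coordGL_poly_monoid : monoid_morphism coordGL_poly.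
Proof.
split=> [|g h]; apply: val_inj; first exact: rmorph1.
exact: rmorphM.
Qed.

HB.instance Definition _ :=
  GRing.isZmodMorphism.Build _ coordGL coordGL_poly coordGL_poly_zmod.
HB.instance Definition _ :=
  GRing.isMonoidMorphism.Build _ coordGL coordGL_poly coordGL_poly_monoid.

Definition coordGL_const : O -> coordGL := coordGL_poly \o @mpolyC (n * n) O.
HB.instance Definition _ := GRing.RMorphism.on coordGL_const.

Definition coordGL_x : 'M[coordGL]_n := map_mx coordGL_poly poly_x.

End CoordGL.

(* A p-derivation on a p-torsion free ring, given with the Frobenius lift
   attached to it.  All rings to which this is applied are p-torsion free. *)
Record pderivation (p : nat) (A : comPzRingType) := PDerivation {
  pder_fun :> A -> A;
  pder_frob : {rmorphism A -> A};
  pder_frobE : forall a, pder_frob a = a ^+ p + p%:R * pder_fun a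
}.

Section Connections.
Variables (p : nat) (O : idomainType) (n : nat) (delta : pderivation p O).

Local Notation R := (coordGL O n).
Local Notation Rhat := (completion p R).

Definition GLhat_const : O -> Rhat := to_completion p \o @coordGL_const O n.

Definition GLhat_x : 'M[Rhat]_n := map_mx (to_completion p) (coordGL_x O n).

Local Notation x := GLhat_x.
Local Notation "A ^(p)" := (map_mx (fun a : Rhat => a ^+ p) A) (at level 2).

Definition is_connection (D : pderivation p Rhat) : Prop :=
  forall a : O, D (GLhat_const a) = GLhat_const (delta a).

(* Ring endomorphisms of a p-adic completion are automatically continuous, so
   each of the next two descriptions determines a unique map. *)
Definition is_trivial_connection (D : pderivation p Rhat) : Prop :=
  is_connection D /\ map_mx (pder_frob D) x = x^(p).

Definition is_Hmap (q : 'M[O]_n) (H : {rmorphism Rhat -> Rhat}) : Prop :=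
  (forall a : O, H (GLhat_const a) = GLhat_const a) /\
  map_mx H x = x^T *m map_mx GLhat_const q *m x.

(* [H] and [D0] exist and are unique, so quantifying them existentially is the
   same as quantifying them universally. *)
Definition is_metric (q : 'M[O]_n) (D : pderivation p Rhat) : Prop :=
  exists (H : {rmorphism Rhat -> Rhat}) (D0 : pderivation p Rhat),
    [/\ is_Hmap q H, is_trivial_connection D0 &
        pder_frob D \o H =1 H \o pder_frob D0].

Definition christoffel (q : 'M[O]_n) (D : pderivation p Rhat) : 'M[Rhat]_n :=
  (map_mx D x)^T *m map_mx GLhat_const (map_mx (pder_frob delta) q) *m x^(p).

Definition is_levi_civita (q : 'I_n -> 'M[O]_n) (D : 'I_n -> pderivation p Rhat)
    : Prop :=
  [/\ forall i, is_connection (D i), forall i, is_metric (q i) (D i) &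
      forall i j k, christoffel (q i) (D i) j k = christoffel (q j) (D j) i k].

(* The ideal of Rhat defining the completion of the closed subscheme V(J):
   the kernel of Rhat -> (R / J)^ = lim_m R / (J + p^m R). *)
Definition completed_ideal (J : set R) : set Rhat :=
  [set f | forall m, exists2 r, J r & pdivides p m (f - to_completion p r)].

Definition horizontal (D : pderivation p Rhat) (J : set R) : Prop :=
  forall f, completed_ideal J f -> completed_ideal J (D f).

End Connections.

Section Subgroups.
Variables (O : idomainType).

Section Points.
Variable n : nat.

(* The B-points of the closed subscheme V(J) of GL_n, as matrices over B, for the
   O-algebra B with structure map s. *)
Definition points (J : set (coordGL O n)) (B : comPzRingType)
    (s : {rmorphism O -> B}) : set 'M[B]_n :=
  [set g | exists f : {rmorphism coordGL O n -> B},
    [/\ forall a, f (coordGL_const n a) = s a, forall r, J r -> f r = 0 &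
        g = map_mx f (coordGL_x O n)]].

Definition is_subgroup_scheme (J : set (coordGL O n)) : Prop :=
  is_ideal J /\
  forall (B : comPzRingType) (s : {rmorphism O -> B}),
    [/\ points J s 1%:M,
        forall g h, points J s g -> points J s h -> points J s (g *m h) &
        forall g, points J s g -> exists2 h, points J s h & h *m g = 1%:M].

End Points.

Definition cmx (R : pzRingType) : 'M[R]_2 := delta_mx 0 1 - delta_mx 1 0.

Local Notation x := (coordGL_x O 2).

(* The ideal of the centralizer of [cmx] in GL_2. *)
Definition GL1c_ideal : set (coordGL O 2) :=
  ideal_gen [set f | exists i j, f = (x *m cmx _ - cmx _ *m x) i j].

(* The ideal of the kernel of det on that centralizer. *)
Definition U1c_ideal : set (coordGL O 2) :=
  ideal_gen (GL1c_ideal `|` [set \det x - 1]).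

End Subgroups.

(* Main.v *)
(* Write Phi_i = phi_i^G(x) and eps_i = d_i^p / phi(d_i), a scalar = 1 mod p.
   The metric condition reads Phi_i^t Phi_i = eps_i (x^t x)^(p), and on G' one
   has x^t x = det x.  Hence on G' the matrix Phi_i has a scalar Gram matrix
   m = eps_i (det x)^p, so that (det Phi_i) Phi_i^t = m adj(Phi_i); as
   det Phi_i + m = 2 (det x)^p mod p is invertible, Phi_i commutes with c and
   det Phi_i = eps_i (det x)^p.  The first fact is 1); the second shows that
   det x = 1 is preserved iff eps_i = 1, i.e. delta d_i = 0, which is 2).

   For 3), the values h_i of Phi_i at the identity are phi-twisted O-points of
   any horizontal subgroup.  The Levi-Civita symmetry gives, with s = 0 mod p,
   h_1 = 1 + s + s i, h_2 = 1 + s - s i in complex notation (c = i), and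
   h_1 h_2 = eps = d^(p-1) is not a root of unity, so s <> 0.  A function on G'
   vanishing at eps^n h_1^(p^e) for all n and e vanishes on each line through
   0 and h_1^(p^e); the slopes of these lines have p-adic valuations increasing
   with e, so the lines are distinct and the function is 0. *)
From HB Require Import structures.
Require Import Defs.
From mathcomp Require Import all_boot all_order all_algebra.
From mathcomp Require Import boolp classical_sets functions.
From mathcomp Require Import mpoly ring.

Set Implicit Arguments.
Unset Strict Implicit.
Unset Printing Implicit Defensive.

Import GRing.Theory.
Local Open Scope classical_set_scope.
Local Open Scope ring_scope.
Local Open Scope quotient_scope.

(** * Divisibility by powers of p and p-adic completions *)

Section PDivides.
Variables (p : nat) (R : comPzRingType).

Lemma pdividesD m (a b : R) :
  pdivides p m a -> pdivides p m b -> pdivides p m (a + b).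
Proof. by move=> [u ->] [v ->]; exists (u + v); rewrite mulrDr. Qed.

Lemma pdividesN m (a : R) : pdivides p m a -> pdivides p m (- a).
Proof. by move=> [u ->]; exists (- u); rewrite mulrN. Qed.

Lemma pdividesB m (a b : R) :
  pdivides p m a -> pdivides p m b -> pdivides p m (a - b).
Proof. by move=> ha /pdividesN; exact: pdividesD. Qed.

Lemma pdividesMl m (a b : R) : pdivides p m b -> pdivides p m (a * b).
Proof. by move=> [u ->]; exists (a * u); rewrite mulrCA. Qed.

Lemma pdivides0 m : pdivides p m (0 : R).
Proof. by exists 0; rewrite mulr0. Qed.

Lemma pdivides_le m n (a : R) : (n <= m)%N -> pdivides p m a -> pdivides p n a.
Proof.
move=> lenm [u ->]; exists (p%:R ^+ (m - n) * u).
by rewrite mulrA -exprD subnKC.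
Qed.

Lemma pdivides_rmorph (S : comPzRingType) (f : {rmorphism R -> S}) m a :
  pdivides p m a -> pdivides p m (f a).
Proof.
by move=> [u ->]; exists (f u); rewrite rmorphM rmorphXn rmorph_nat.
Qed.

Lemma pdivides_cauchy (u : nat -> R) m k :
  (forall m, pdivides p m (u m.+1 - u m)) -> (m <= k)%N ->
  pdivides p m (u k - u m).
Proof.
move=> hu /subnKC <-; elim: (k - m)%N => [|j IH].
  by rewrite addn0 subrr; exact: pdivides0.
rewrite addnS -(subrK (u (m + j)%N) (u _.+1)) -addrA.
by apply: pdividesD => //; apply: pdivides_le (hu _); rewrite leq_addr.
Qed.

Definition ptorsion_free := forall a : R, p%:R * a = 0 -> a = 0.

Lemma ptorsion_freeX m (a : R) : ptorsion_free -> p%:R ^+ m * a = 0 -> a = 0.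
Proof.
move=> tf; elim: m => [|m IH]; first by rewrite expr0 mul1r.
by rewrite exprS -mulrA => /tf /IH.
Qed.

End PDivides.

Section CompletionTheory.
Variables (p : nat) (R : comPzRingType).
Local Notation Rhat := (completion p R).

Lemma completionP (a : Rhat) : exists u : coherent p R, a = \pi_Rhat u.
Proof. by exists (repr a); rewrite reprK. Qed.

Lemma coherentP (u : coherent p R) m : pdivides p m (u m.+1 - u m).
Proof. by move: m; apply: asboolW; exact: (valP u). Qed.

Lemma coherentM (u v : coherent p R) m : (u * v) m = u m * v m.
Proof. by []. Qed.

Lemma coherentB (u v : coherent p R) m : (u - v) m = u m - v m.
Proof. by []. Qed.

Lemma pi_completion_eq (u v : coherent p R) :
  (\pi_Rhat u = \pi_Rhat v) <-> (forall m, pdivides p m (u m - v m)).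
Proof.
split=> [h|h].
  have: u - v \in @null_pred p R by rewrite Quotient.idealrBE h.
  by move=> /asboolP.
by apply/eqP; rewrite -Quotient.idealrBE; apply/asboolP.
Qed.

Lemma to_completionE (r : R) :
  to_completion p r = \pi_Rhat (Coherent (const_coherent p r)).
Proof. by []. Qed.

Lemma pi_completionM (u v : coherent p R) :
  \pi_Rhat u * \pi_Rhat v = \pi_Rhat (u * v).
Proof. by rewrite [RHS]pi_completion_mulP. Qed.

Lemma pi_completionB (u v : coherent p R) :
  \pi_Rhat u - \pi_Rhat v = \pi_Rhat (u - v).
Proof. by rewrite !piE. Qed.

Hypothesis tf : @ptorsion_free p R.

(** Coherence gives [u (k + m)] = [u m] mod p^m, so once [u m] is divisible by p^m all later terms
    are, and their quotients represent the class divided by p^m. *)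
Lemma pdivides_pi (u : coherent p R) m :
  pdivides p m (\pi_Rhat u) <-> pdivides p m (u m).
Proof.
have pX : p%:R ^+ m = to_completion p (p%:R ^+ m : R).
  by rewrite rmorphXn rmorph_nat.
split=> [[a]|hm].
  have [v ->] := completionP a; rewrite pX to_completionE pi_completionM.
  move/pi_completion_eq/(_ m) => h; rewrite -(subrK (p%:R ^+ m * v m) (u m)).
  by apply: pdividesD => //; exists (v m).
have hk k : exists c, u (k + m)%N = p%:R ^+ m * c.
  have : pdivides p m (u (k + m)%N - u m + u m).
    apply: pdividesD => //.
    by apply: pdivides_cauchy; [exact: coherentP|exact: leq_addl].
  by rewrite subrK.
(* The shift by m compensates the division by p^m: [u (k + m)] is determined mod p^(k + m), hence
   [c k] mod p^k, as R is p-torsion free. *)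
pose c k := projT1 (cid (hk k)).
have cE k : u (k + m)%N = p%:R ^+ m * c k by rewrite /c; case: cid.
have c_coh : c \in @coherent_pred p R.
  apply/asboolP => k; have [b hb] := coherentP u (k + m); exists b.
  apply/eqP; rewrite -subr_eq0; apply/eqP/(@ptorsion_freeX p R m) => //.
  by rewrite mulrBr mulrBr -!cE hb mulrA -exprD addnC subrr.
exists (\pi_Rhat (Coherent c_coh)).
rewrite pX to_completionE pi_completionM; apply/pi_completion_eq => k.
rewrite coherentM -cE -opprB; apply: pdividesN.
by apply: pdivides_cauchy; [exact: coherentP|exact: leq_addr].
Qed.

Lemma to_completion_dense (a : Rhat) m :
  exists r, pdivides p m (a - to_completion p r).
Proof.
have [u ->] := completionP a; exists (u m).
rewrite to_completionE pi_completionB; apply/pdivides_pi.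
by exists 0; rewrite mulr0 coherentB subrr.
Qed.

Lemma pdivides_to_completion (r : R) m :
  pdivides p m (to_completion p r) <-> pdivides p m r.
Proof. by rewrite to_completionE pdivides_pi. Qed.

(** Cancelling p costs one power of p, so [u m] is tested through [u m.+1], which agrees with it mod
    p^m. *)
Lemma completion_ptorsion_free : @ptorsion_free p Rhat.
Proof.
move=> a; have [u ->] := completionP a.
have -> : p%:R = to_completion p (p%:R : R) by rewrite rmorph_nat.
rewrite to_completionE pi_completionM.
have -> : 0 = to_completion p (0 : R) by rewrite rmorph0.
rewrite to_completionE => /pi_completion_eq h; apply/pi_completion_eq => m.
rewrite /= subr0; have [b] := h m.+1; rewrite coherentM /= subr0.
rewrite exprS -mulrA => /eqP.
rewrite -subr_eq0 -mulrBr => /eqP/tf/eqP; rewrite subr_eq0 => /eqP e.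
rewrite -(subKr (u m.+1) (u m)).
by apply: pdividesB; [exists b|exact: coherentP].
Qed.

End CompletionTheory.

(** The extension sends the class of u to the limit of the [f (u m)]. As B is separated, this limit
    is characterized by congruences modulo all p^m, which yield well-definedness and the ring
    laws. *)
Lemma completion_extension (p : nat) (R B : comPzRingType)
    (f : {rmorphism R -> B}) : padically_complete p B ->
  exists fh : {rmorphism completion p R -> B},
    forall r, fh (to_completion p r) = f r.
Proof.
move=> [sep lim].
pose Rhat := completion p R.
have hlim (a : Rhat) : exists l, forall m, pdivides p m (l - f (repr a m)).
  apply: lim => m; rewrite -rmorphB; apply: pdivides_rmorph.
  exact: coherentP.
pose g a := projT1 (cid (hlim a)).
have gP (u : coherent p R) m : pdivides p m (g (\pi_Rhat u) - f (u m)).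
  rewrite /g; case: cid => l /= /(_ m) h.
  rewrite -(subrK (f (repr (\pi_Rhat u) m)) l) -addrA; apply: pdividesD => //.
  rewrite -rmorphB; apply: pdivides_rmorph; move: m {h}; apply/pi_completion_eq.
  by rewrite reprK.
have gU (u : coherent p R) b :
    (forall m, pdivides p m (b - f (u m))) -> g (\pi_Rhat u) = b.
  move=> hb; apply/eqP; rewrite -subr_eq0; apply/eqP/sep => m.
  rewrite -(subrK (f (u m)) (g _)) -addrA; apply: pdividesD => //.
  by rewrite -opprB; exact: pdividesN.
have gB : zmod_morphism g.
  move=> a b; have [u ->] := completionP a; have [v ->] := completionP b.
  rewrite pi_completionB; apply: gU => m.
  rewrite coherentB rmorphB; rewrite [X in pdivides p m X](_ : _ =
    (g (\pi_Rhat u) - f (u m)) - (g (\pi_Rhat v) - f (v m))); last by ring.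
  exact: pdividesB.
have gM : monoid_morphism g.
  split=> [|a b].
    have -> : 1 = to_completion p (1 : R) by rewrite rmorph1.
    rewrite to_completionE; apply: gU => m.
    by rewrite /= rmorph1 subrr; exact: pdivides0.
  have [u ->] := completionP a; have [v ->] := completionP b.
  rewrite pi_completionM; apply: gU => m.
  rewrite coherentM rmorphM.
  rewrite [X in pdivides p m X](_ : _ =
    g (\pi_Rhat v) * (g (\pi_Rhat u) - f (u m))
    + f (u m) * (g (\pi_Rhat v) - f (v m))); last by ring.
  by apply: pdividesD; exact: pdividesMl.
pose gh : {rmorphism Rhat -> B} := HB.pack g
  (GRing.isZmodMorphism.Build _ _ g gB) (GRing.isMonoidMorphism.Build _ _ g gM).
exists gh => r; apply: gU => m.
by rewrite /= subrr; exact: pdivides0.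
Qed.

(** * Ideals, evaluations and completed ideals *)

Section IdealTheory.
Variables (R : comPzRingType) (J : set R).
Hypothesis J_ideal : is_ideal J.

Lemma is_ideal0 : J 0. Proof. by case: J_ideal. Qed.

Lemma is_idealD a b : J a -> J b -> J (a + b).
Proof. by case: J_ideal => _ + _; apply. Qed.

Lemma is_idealMl a b : J b -> J (a * b).
Proof. by case: J_ideal => _ _; apply. Qed.

Lemma is_idealMr a b : J a -> J (a * b).
Proof. by rewrite mulrC; exact: is_idealMl. Qed.

Lemma is_idealN a : J a -> J (- a).
Proof. by rewrite -mulN1r; exact: is_idealMl. Qed.

Lemma is_idealB a b : J a -> J b -> J (a - b).
Proof. by move=> ha /is_idealN; exact: is_idealD. Qed.

Lemma is_idealX m a : (0 < m)%N -> J a -> J (a ^+ m).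
Proof. by case: m => // m _ ?; rewrite exprS; exact: is_idealMr. Qed.

Lemma is_idealBC a b : J (a - b) -> J (b - a).
Proof. by move/is_idealN; rewrite opprB. Qed.

Lemma is_idealB_trans b a c : J (a - b) -> J (b - c) -> J (a - c).
Proof. by move=> hab hbc; rewrite -(subrK b a) -addrA; exact: is_idealD. Qed.

Lemma is_idealB_mem a b : J (a - b) -> J b -> J a.
Proof. by move=> hab hb; rewrite -(subrK b a); exact: is_idealD. Qed.

Lemma is_idealBD a a' b b' : J (a - a') -> J (b - b') -> J (a + b - (a' + b')).
Proof. by move=> ha hb; rewrite opprD addrACA; exact: is_idealD. Qed.

Lemma is_idealBM a a' b b' : J (a - a') -> J (b - b') -> J (a * b - a' * b').
Proof.
move=> ha hb; have -> : a * b - a' * b' = b * (a - a') + a' * (b - b') by ring.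
by apply: is_idealD; exact: is_idealMl.
Qed.

Lemma is_idealBMl c a b : J (a - b) -> J (c * a - c * b).
Proof. by rewrite -mulrBr; exact: is_idealMl. Qed.

Lemma is_idealBX m a b : J (a - b) -> J (a ^+ m - b ^+ m).
Proof.
move=> hab; elim: m => [|m IH]; first by rewrite !expr0 subrr; exact: is_ideal0.
by rewrite !exprS; exact: is_idealBM.
Qed.

End IdealTheory.

Lemma ideal_gen_ideal (R : comPzRingType) (S : set R) : is_ideal (ideal_gen S).
Proof.
split=> [A [hA _]|a b ha hb A hAS|a b hb A hAS]; first exact: is_ideal0.
  by case: (hAS) => hA _; apply: is_idealD => //; [exact: ha|exact: hb].
by case: (hAS) => hA _; apply: is_idealMl => //; exact: hb.
Qed.

Lemma sub_ideal_gen (R : comPzRingType) (S : set R) : S `<=` ideal_gen S.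
Proof. by move=> a ha A [_]; apply. Qed.

Lemma ideal_gen_sub (R : comPzRingType) (S J : set R) :
  is_ideal J -> S `<=` J -> ideal_gen S `<=` J.
Proof. by move=> hJ hS a; apply. Qed.

Lemma ideal_preim (R S : comPzRingType) (f : {rmorphism R -> S}) (J : set S) :
  is_ideal J -> is_ideal (f @^-1` J).
Proof.
move=> hJ; split=> [|a b|a b]; rewrite /preimage /= ?rmorph0 ?rmorphD ?rmorphM.
- exact: is_ideal0.
- exact: is_idealD.
- exact: is_idealMl.
Qed.

Lemma is_ideal_ker (R S : comPzRingType) (f : {rmorphism R -> S}) :
  is_ideal [set r | f r = 0].
Proof.
split=> [|a b /= fa fb|a b /= fb]; first exact: rmorph0.
  by rewrite rmorphD fa fb addr0.
by rewrite rmorphM fb mulr0.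
Qed.

(** * Evaluation of the coordinate ring of GL_n at an invertible matrix *)

Section CoordEval.
Variables (O : idomainType) (n : nat).
Local Notation R := (coordGL O n).

Lemma coordGL_valM (r s : R) : val (r * s) = val r * val s.
Proof. exact: rmorphM. Qed.

Lemma coordGL_fracP (r : R) : exists g k,
  coordGL_poly g = r * (\det (coordGL_x O n)) ^+ k.
Proof.
have /asboolP[g [k e]] := valP r; exists g, k; apply: val_inj.
rewrite det_map_mx -rmorphXn coordGL_valM e /= rmorphXn mulfVK //.
by rewrite expf_neq0 // tofrac_eq0 det_poly_x_neq0.
Qed.

Lemma det_coordGL_x_inv : exists u : R, u * \det (coordGL_x O n) = 1.
Proof.
have h : (tofrac (\det (poly_x O n)))^-1 \in coordGL_pred (O:=O) (n:=n).
  by apply/asboolP; exists 1, 1%N; rewrite rmorph1 div1r expr1.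
exists (CoordGL h); apply: val_inj.
by rewrite det_map_mx coordGL_valM /= mulVf // tofrac_eq0 det_poly_x_neq0.
Qed.

Lemma coordGL_ptorsion_free (p : nat) :
  p%:R != 0 :> O -> @ptorsion_free p R.
Proof.
move=> p0 r /(congr1 val); rewrite coordGL_valM rmorph_nat => /eqP.
rewrite mulf_eq0 => /orP[|/eqP h]; last by apply: val_inj; rewrite h.
rewrite -(rmorph_nat (@tofrac {mpoly O[n * n]})) tofrac_eq0 -mpolyC_nat.
by rewrite mpolyC_eq0 (negPf p0).
Qed.

Section Eval.
Variables (B : comUnitRingType) (s : {rmorphism O -> B}) (g : 'M[B]_n).
Hypothesis g_unit : \det g \is a GRing.unit.

Let ev : {rmorphism {mpoly O[n * n]} -> B} := mmap s (fun k => mxvec g 0 k).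

Let ev_x : map_mx ev (poly_x O n) = g.
Proof.
by apply/matrixP => i j; rewrite !mxE [LHS]mmapX mmap1U mxvecE.
Qed.

Let ev_det : ev (\det (poly_x O n)) = \det g.
Proof. by rewrite -det_map_mx ev_x. Qed.

(** Universal property of the localization at the determinant: the fraction h / det(x)^k goes to
    [ev h / \det g ^+ k]. *)
Lemma coordGL_eval : exists f : {rmorphism R -> B},
  (forall a, f (coordGL_const n a) = s a) /\ map_mx f (coordGL_x O n) = g.
Proof.
have polyMD h k : coordGL_poly (h * \det (poly_x O n) ^+ k)
    = coordGL_poly h * \det (coordGL_x O n) ^+ k.
  by rewrite det_map_mx -rmorphXn -rmorphM.
have polyB h h' : coordGL_poly (h - h') = coordGL_poly h - coordGL_poly h' :> R.
  exact: rmorphB.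
have polyM h h' : coordGL_poly (h * h') = coordGL_poly h * coordGL_poly h' :> R.
  exact: rmorphM.
(* The value at r is specified through all of its fractions at once, so that any convenient fraction
   serves for sums and products. *)
have ex (r : R) : exists b, forall h k,
    coordGL_poly h = r * (\det (coordGL_x O n)) ^+ k -> ev h = b * \det g ^+ k.
  have [h [k e]] := coordGL_fracP r.
  exists (ev h / \det g ^+ k) => h' k' e'.
  have : coordGL_poly (h' * \det (poly_x O n) ^+ k)
      = coordGL_poly (h * \det (poly_x O n) ^+ k').
    by rewrite !polyMD e e' mulrAC.
  move=> /(congr1 val) /= /eqP; rewrite tofrac_eq => /eqP /(congr1 ev).
  rewrite !rmorphM !rmorphXn !ev_det => e2.
  apply: (mulIr (unitrX k g_unit)); rewrite e2.
  by rewrite mulrAC divrK // unitrX.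
pose f r := projT1 (cid (ex r)).
have fP r h k : coordGL_poly h = r * (\det (coordGL_x O n)) ^+ k ->
    ev h = f r * \det g ^+ k.
  by rewrite /f; case: cid => b /= hb /hb.
have f_poly h : f (coordGL_poly h) = ev h.
  by rewrite (fP (coordGL_poly h) h 0%N) expr0 mulr1.
have inj k a b : a * \det g ^+ k = b * \det g ^+ k -> a = b.
  by apply: mulIr; exact: unitrX.
have ring_id (S : comPzRingType) (a b c d : S) :
    a * c * d - b * d * c = (a - b) * (c * d) by ring.
have fB : zmod_morphism f.
  move=> a b; have [h [k e]] := coordGL_fracP a.
  have [h' [k' e']] := coordGL_fracP b.
  apply: (inj (k + k')%N).
  rewrite -(fP (a - b) (h * \det (poly_x O n) ^+ k' - h' * \det (poly_x O n) ^+ k)).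
    rewrite rmorphB !rmorphM !rmorphXn !ev_det (fP _ _ _ e) (fP _ _ _ e').
    by rewrite exprD ring_id.
  by rewrite polyB !polyMD e e' exprD ring_id.
have fM : monoid_morphism f.
  split=> [|a b].
    by have := f_poly 1; rewrite !rmorph1.
  have [h [k e]] := coordGL_fracP a; have [h' [k' e']] := coordGL_fracP b.
  apply: (inj (k + k')%N); rewrite -(fP (a * b) (h * h')).
    by rewrite rmorphM (fP _ _ _ e) (fP _ _ _ e') exprD mulrACA.
  by rewrite polyM e e' exprD mulrACA.
pose fh : {rmorphism R -> B} := HB.pack f
  (GRing.isZmodMorphism.Build _ _ f fB) (GRing.isMonoidMorphism.Build _ _ f fM).
exists fh; split=> [a|]; first by rewrite [LHS]f_poly [LHS]mmapC.
by rewrite -ev_x; apply/matrixP => i j; rewrite !mxE [LHS]f_poly.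
Qed.

End Eval.
End CoordEval.

(** * Ideals of completed subschemes and horizontality *)

Section CompletedIdeal.
Variables (p : nat) (O : idomainType) (n : nat) (J : set (coordGL O n)).
Hypothesis p_neq0 : p%:R != 0 :> O.
Hypothesis J_ideal : is_ideal J.
Local Notation R := (coordGL O n).
Local Notation Rhat := (completion p R).
Local Notation Jhat := (@completed_ideal p O n J).

Let tf : @ptorsion_free p R := coordGL_ptorsion_free p_neq0.

(** For products, density replaces the multiplier modulo p^m by some t in R, and [t * s] stays in
    J. *)
Lemma completed_ideal_ideal : is_ideal Jhat.
Proof.
split=> [m|a b ha hb m|a b hb m].
- by exists 0; [exact: is_ideal0|rewrite rmorph0 subrr; exact: pdivides0].
- have [r hr pr] := ha m; have [s hs ps] := hb m.
  exists (r + s); first exact: is_idealD.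
  by rewrite rmorphD opprD addrACA; exact: pdividesD.
- have [s hs ps] := hb m; have [t pt] := to_completion_dense tf a m.
  exists (t * s); first exact: is_idealMl.
  have -> : a * b - to_completion p (t * s)
    = a * (b - to_completion p s) + to_completion p s * (a - to_completion p t).
    have ring_id (S : comPzRingType) (x y z w : S) :
      x * y - w * z = x * (y - z) + z * (x - w) by ring.
    by rewrite rmorphM ring_id.
  by apply: pdividesD; exact: pdividesMl.
Qed.
Let Jhi := completed_ideal_ideal.

Lemma to_completion_ideal r : J r -> Jhat (to_completion p r).
Proof. by move=> hr m; exists r => //; rewrite subrr; exact: pdivides0. Qed.

Lemma completed_ideal_closed f :
  (forall m, exists2 g, Jhat g & pdivides p m (f - g)) -> Jhat f.
Proof.
move=> h m; have [g /(_ m)[r hr pr] pg] := h m; exists r => //.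
by rewrite -(subrK g f) -addrA; exact: pdividesD.
Qed.

(* Modulo p^m, the inverse of 1 + p w is a truncated geometric series. *)
Lemma completed_ideal_unit v w u f :
  v * u = 1 + p%:R * w -> Jhat (v * f) -> Jhat f.
Proof.
move=> e hf; apply: completed_ideal_closed => m.
exists ((1 - (- (p%:R * w)) ^+ m) * f); last first.
  exists ((- w) ^+ m * f).
  by rewrite mulrA -exprMn mulrN mulrBl mul1r subKr.
rewrite -[X in (X - _ ^+ m)](expr1n _ m) subrXX.
set S := (X in _ * X * f); rewrite (_ : _ * f = S * u * (v * f)).
  exact: (is_idealMl Jhi).
have ring_id (S' : comPzRingType) (x y z t : S') : x * y * z * t = z * y * (x * t).
  by ring.
by rewrite opprK -e ring_id.
Qed.

(** An element r of J close to p f modulo p^(m+1) is itself of the form p s; saturation puts s in J,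
    and cancelling p shows that s is close to f modulo p^m. *)
Lemma completed_ideal_saturated f :
  (forall r, J (p%:R * r) -> J r) -> Jhat (p%:R * f) -> Jhat f.
Proof.
move=> sat hf m; have [r hr pr] := hf m.+1.
have [s hs] : pdivides p 1 r.
  apply/(pdivides_to_completion tf).
  rewrite -[X in pdivides _ _ X](subKr (p%:R * f)).
  apply: pdividesB; first by exists f; rewrite expr1.
  by apply: pdivides_le pr.
exists s; first by apply: sat; rewrite -(expr1 p%:R) -hs.
case: pr => b; rewrite hs expr1 rmorphM rmorph_nat -mulrBr exprS -mulrA => e.
exists b; apply/eqP; rewrite -subr_eq0; apply/eqP.
by apply: (completion_ptorsion_free tf); rewrite mulrBr e subrr.
Qed.

Section Horizontal.
Let p_gt0 : (0 < p)%N.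
Proof. by rewrite lt0n; apply: contraNneq p_neq0 => ->. Qed.

Variable D : pderivation p Rhat.

Lemma horizontal_frob f :
  horizontal D J -> Jhat f -> Jhat (pder_frob D f).
Proof.
move=> hD hf; rewrite pder_frobE; apply: (is_idealD Jhi); last first.
  by apply: (is_idealMl Jhi); exact: hD.
exact: (is_idealX Jhi).
Qed.

(** Since p D(f) = phi(f) - f^p, with phi the attached Frobenius lift, saturation reduces the claim
    to phi; by p-adic continuity phi has to be tested on J alone. *)
Lemma frob_horizontal : (forall r, J (p%:R * r) -> J r) ->
  (forall r, J r -> Jhat (pder_frob D (to_completion p r))) -> horizontal D J.
Proof.
move=> sat hJ f hf; apply: completed_ideal_saturated => //.
rewrite (_ : _ * _ = pder_frob D f - f ^+ p); last first.
  by rewrite pder_frobE addrC addKr.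
apply: (is_idealB Jhi); last first.
  exact: (is_idealX Jhi).
apply: completed_ideal_closed => m; have [r hr pr] := hf m.
exists (pder_frob D (to_completion p r)); first exact: hJ.
by rewrite -rmorphB; exact: pdivides_rmorph.
Qed.

End Horizontal.
End CompletedIdeal.

Lemma completed_ideal_sub (p : nat) (O : idomainType) (n : nat)
  (J J' : set (coordGL O n)) :
  J `<=` J' -> @completed_ideal p O n J `<=` @completed_ideal p O n J'.
Proof. by move=> h f hf m; have [r /h] := hf m; exists r. Qed.

Lemma completed_ideal_eval (p : nat) (O : idomainType) (n : nat)
    (J : set (coordGL O n)) (B : comPzRingType)
    (f : {rmorphism coordGL O n -> B})
    (fh : {rmorphism completion p (coordGL O n) -> B}) :
  padically_complete p B -> (forall r, fh (to_completion p r) = f r) ->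
  (forall r, J r -> f r = 0) -> forall a, completed_ideal J a -> fh a = 0.
Proof.
move=> [sep _] fhE fJ a ha; apply: sep => m; have [r /fJ hr pr] := ha m.
by rewrite -[fh a]subr0 -hr -fhE -rmorphB; exact: pdivides_rmorph.
Qed.

(** * The subgroups GL_1^c and U_1^c *)

Lemma forall_ord2 (P : 'I_2 -> Prop) : P 0 -> P 1 -> forall i, P i.
Proof.
move=> P0 P1 [[|[|//]] hi]; first by rewrite (_ : Ordinal hi = 0) //; exact: val_inj.
by rewrite (_ : Ordinal hi = 1) //; exact: val_inj.
Qed.

Lemma lift0_ord2 : lift (ord0 : 'I_2) ord0 = 1.
Proof. exact: val_inj. Qed.

Lemma sum_ord2 (V : nmodType) (F : 'I_2 -> V) : \sum_i F i = F 0 + F 1.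
Proof. by rewrite !big_ord_recl big_ord0 addr0 lift0_ord2. Qed.

Lemma det_mx22 (R : comPzRingType) (M : 'M[R]_2) :
  \det M = M 0 0 * M 1 1 - M 0 1 * M 1 0.
Proof.
rewrite (expand_det_row _ 0) sum_ord2 /cofactor !det_mx11 !mxE /=.
by rewrite expr0 expr1 mul1r mulN1r mulrN; congr (_ * M _ _ - _ * M _ _);
  exact: val_inj.
Qed.

Lemma cmx_commE (R : pzRingType) (M : 'M[R]_2) (N := M *m cmx R - cmx R *m M) :
  [/\ N 0 0 = - (M 0 1 + M 1 0), N 0 1 = M 0 0 - M 1 1,
      N 1 0 = M 0 0 - M 1 1 & N 1 1 = M 0 1 + M 1 0].
Proof.
by split; rewrite !mxE !sum_ord2 !mxE /= ?mulr1n ?mulr0n;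
  rewrite ?(mulr1, mulr0, mul1r, mul0r, addr0, add0r, subr0, sub0r, mulrN, mulNr,
    opprK, opprD, oppr0) // addrC.
Qed.

(* The complex number a + b i, with i = [cmx]. *)
Definition gl1mx (R : pzRingType) (a b : R) : 'M[R]_2 :=
  \matrix_(i, j) if i == j then a else if i == 0 then b else - b.

(* In {poly {poly A}} the inner variable plays the role of alpha, the outer one
   that of beta. *)
Section Bieval.
Variables (A B : comNzRingType) (s : {rmorphism A -> B}) (u v : B).

Definition bieval_in : {poly A} -> B := horner_morph (fun a => mulrC u (s a)).
HB.instance Definition _ := GRing.RMorphism.on bieval_in.
Definition bieval : {poly {poly A}} -> B :=
  horner_morph (fun q => mulrC v (bieval_in q)).
HB.instance Definition _ := GRing.RMorphism.on bieval.

Lemma bievalCC a : bieval a%:P%:P = s a.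
Proof. by rewrite /bieval horner_morphC /= /bieval_in horner_morphC. Qed.

Lemma bievalXC : bieval 'X%:P = u.
Proof. by rewrite /bieval horner_morphC /= /bieval_in horner_morphX. Qed.

Lemma bievalX : bieval 'X = v.
Proof. by rewrite /bieval horner_morphX. Qed.

Lemma bieval_unique (g : {rmorphism {poly {poly A}} -> B}) :
  (forall a, g a%:P%:P = s a) -> g 'X%:P = u -> g 'X = v -> g =1 bieval.
Proof.
move=> gC gu gv; elim/poly_ind => [|F c IH]; first by rewrite !rmorph0.
rewrite !rmorphD !rmorphM /= IH gv bievalX; congr (_ + _).
elim/poly_ind: c => [|f c IH2]; first by rewrite !rmorph0.
by rewrite !rmorphD !rmorphM /= IH2 gC gu bievalXC bievalCC.
Qed.

End Bieval.

Lemma rmorph_bieval (A B C : comNzRingType) (s : {rmorphism A -> B})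
    (f : {rmorphism B -> C}) (t : {rmorphism A -> C}) (u v : B) F :
  (forall a, f (s a) = t a) -> f (bieval s u v F) = bieval t (f u) (f v) F.
Proof.
move=> fs; apply: (bieval_unique (g := f \o bieval s u v)) => /= [a||].
- by rewrite bievalCC.
- by rewrite bievalXC.
- by rewrite bievalX.
Qed.

Section Circle.
Variable A : idomainType.

(** The determinant alpha^2 + beta^2 on GL_1^c; it is monic in beta. *)
Definition norm_poly : {poly {poly A}} := 'X ^+ 2 + ('X ^+ 2)%:P.

Lemma norm_poly_monic c : norm_poly - c%:P \is monic.
Proof.
rewrite /norm_poly -addrA -rmorphB monicE lead_coefDl ?lead_coefXn //.
by rewrite size_polyXn (leq_ltn_trans (size_polyC_leq1 _)).
Qed.

Lemma norm_poly_neq0 : norm_poly != 0.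
Proof. by rewrite -[norm_poly]subr0 -polyC0 monic_neq0 ?norm_poly_monic. Qed.

End Circle.

(** Division with remainder K = q M + K' gives M (H - c q) = c K', and the degree of K' forces both
    sides to vanish. [U1c_saturated] uses it with c = p. *)
Lemma monic_mulC_factor (A : idomainType) (M H K : {poly A}) (c : A) :
  M \is monic -> M * H = c%:P * K -> exists H', H = c%:P * H'.
Proof.
move=> Mm e; exists (K %/ M)%R; apply/eqP; rewrite -subr_eq0.
have eK : K = (K %/ M) * M + K %% M.
  exact: (Pdiv.IdomainMonic.divp_eq Mm).
have e2 : M * (H - c%:P * (K %/ M)) = c%:P * (K %% M).
  by rewrite mulrBr e {1}eK; move: (K %/ M) (K %% M) => q r; ring.
apply: contraTT isT => H0.
have : (size (c%:P * (K %% M))%R < size M)%N.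
  apply: (leq_ltn_trans (size_polyMleq _ _)).
  have := ltn_modp K M; rewrite (monic_neq0 Mm) => lt.
  have := size_polyC_leq1 c; case: (size c%:P) => [|[|//]] _ //=.
  by apply: leq_ltn_trans lt; exact: leq_pred.
rewrite -e2 size_monicM // => {e2}.
by rewrite -(prednK (n := size (H - _))) ?size_poly_gt0 // addnS /= ltnNge leq_addr.
Qed.

(** * The coordinate rings of GL_1^c and U_1^c as quotients of that of GL_2 *)

Section GL1c.
Variable O : idomainType.
Local Notation R := (coordGL O 2).
Local Notation X := (coordGL_x O 2).
Local Notation D := (\det (coordGL_x O 2)).
Local Notation J1 := (@GL1c_ideal O).
Local Notation J2 := (@U1c_ideal O).

Lemma GL1c_is_ideal : is_ideal J1.
Proof. exact: ideal_gen_ideal. Qed.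

Lemma U1c_is_ideal : is_ideal J2.
Proof. exact: ideal_gen_ideal. Qed.

Lemma GL1c_ideal_gens : J1 (X 0 1 + X 1 0) /\ J1 (X 0 0 - X 1 1).
Proof.
have [_ e01 _ e11] := cmx_commE X.
by split; apply: sub_ideal_gen; [exists 1, 1; rewrite e11|exists 0, 1; rewrite e01].
Qed.

Lemma GL1c_ideal_sub (J : set R) : is_ideal J ->
  J (X 0 1 + X 1 0) -> J (X 0 0 - X 1 1) -> J1 `<=` J.
Proof.
move=> hJ hb ha; apply: ideal_gen_sub => // f [i [j ->]].
have [e00 e01 e10 e11] := cmx_commE X.
move: i j; apply: forall_ord2; apply: forall_ord2;
  by rewrite ?e00 ?e01 ?e10 ?e11 //; exact: (is_idealN hJ).
Qed.

Lemma GL1c_sub_U1c : J1 `<=` J2.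
Proof.
apply: ideal_gen_sub; first exact: U1c_is_ideal.
by move=> f hf; apply: sub_ideal_gen; left; apply: sub_ideal_gen.
Qed.

Lemma U1c_det : J2 (D - 1).
Proof. by apply: sub_ideal_gen; right. Qed.

Lemma U1c_idealP (r : R) : J2 r -> exists h, J1 (r - (D - 1) * h).
Proof.
move: r; apply: ideal_gen_sub.
  split=> [|a b [h hh] [k hk]|a b [h hh]].
  - by exists 0; rewrite mulr0 subr0; exact: (is_ideal0 GL1c_is_ideal).
  - exists (h + k); rewrite mulrDr opprD addrACA.
    exact: (is_idealD GL1c_is_ideal).
  - by exists (a * h); rewrite mulrCA -mulrBr; exact: (is_idealMl GL1c_is_ideal).
move=> r [hr|->].
  by exists 0; rewrite mulr0 subr0.
by exists 1; rewrite mulr1 subrr; exact: (is_ideal0 GL1c_is_ideal).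
Qed.

Lemma is_ideal_det (J : set R) k (r : R) : is_ideal J -> J (r * D ^+ k) -> J r.
Proof.
move=> hJ h; have [u hu] := det_coordGL_x_inv O 2.
have -> : r = u ^+ k * (r * D ^+ k).
  by rewrite mulrCA -exprMn hu expr1n mulr1.
exact: (is_idealMl hJ).
Qed.

(** A polynomial in alpha, beta is read in the first row of x. By [gl1_lift_norm], [gl1_lift_surj]
    and [gl1_lift_inj], [R] modulo [J1] is O[alpha, beta] localized at the norm. *)
Definition gl1_lift : {poly {poly O}} -> R :=
  bieval (@coordGL_const O 2) (X 0 0) (X 0 1).
HB.instance Definition _ := GRing.RMorphism.on gl1_lift.

Lemma GL1c_ker (S : comPzRingType) (f : {rmorphism R -> S}) :
  map_mx f X = 1%:M -> forall r, J1 r -> f r = 0.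
Proof.
move=> fx; have fX i j : f (X i j) = (i == j)%:R.
  by have := congr1 (fun M : 'M_2 => M i j) fx; rewrite [LHS]mxE => ->; rewrite mxE.
apply: (GL1c_ideal_sub (J := [set r | f r = 0])); first exact: is_ideal_ker.
- by rewrite /= rmorphD !fX addr0.
- by rewrite /= rmorphB !fX subrr.
Qed.

Lemma gl1_lift_norm : J1 (gl1_lift (norm_poly O) - D).
Proof.
have [hb ha] := GL1c_ideal_gens.
have -> : gl1_lift (norm_poly O) - D =
    X 0 0 * (X 0 0 - X 1 1) + X 0 1 * (X 0 1 + X 1 0).
  rewrite /norm_poly rmorphD !rmorphXn /= /gl1_lift bievalX bievalXC det_mx22.
  have ring_id (S : comPzRingType) (a b c d : S) :
    b ^+ 2 + a ^+ 2 - (a * d - b * c) = a * (a - d) + b * (b + c) by ring.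
  by rewrite ring_id.
by apply: (is_idealD GL1c_is_ideal); apply: (is_idealMl GL1c_is_ideal).
Qed.

(** Clearing the denominator leaves a polynomial in the entries of x, each of which is alpha, beta
    or - beta modulo [J1]. *)
Lemma gl1_lift_surj (r : R) : exists k F, J1 (r * D ^+ k - gl1_lift F).
Proof.
have [g [k e]] := coordGL_fracP r; exists k; rewrite -{r k}e.
have hJ := GL1c_is_ideal; have [hb ha] := GL1c_ideal_gens.
move: g; elim/mpolyind => [|c m g _ _ [F IH]].
  by exists 0; rewrite !rmorph0 subr0; exact: (is_ideal0 hJ).
suff [G hG] : exists G, J1 (coordGL_poly 'X_[m] - gl1_lift G).
  exists (c%:P%:P * G + F).
  rewrite -mul_mpolyC !rmorphD !rmorphM /=; apply: (is_idealBD hJ) => //.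
  apply: (is_idealBM hJ) => //; rewrite [X in _ - X]bievalCC.
  by rewrite [X in _ - X](_ : _ = coordGL_poly c%:MP) // subrr; exact: (is_ideal0 hJ).
rewrite mpolyXE_id.
elim/big_ind : _ => [|a b [G hG] [H hH]|i _].
- by exists 1; rewrite !rmorph1 subrr; exact: (is_ideal0 hJ).
- by exists (G * H); rewrite !rmorphM; exact: (is_idealBM hJ).
suff [G hG] : exists G, J1 (coordGL_poly 'X_i - gl1_lift G).
  exists (G ^+ m i); rewrite !rmorphXn; elim: (m i) => [|j IHj].
    by rewrite !expr0 subrr; exact: (is_ideal0 hJ).
  by rewrite !exprS; exact: (is_idealBM hJ).
have [j l] := mxvec_indexP i.
rewrite (_ : coordGL_poly _ = X j l); last by rewrite !mxE.
move: j l; apply: forall_ord2; apply: forall_ord2.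
- by exists 'X%:P; rewrite /gl1_lift bievalXC subrr; exact: (is_ideal0 hJ).
- by exists 'X; rewrite /gl1_lift bievalX subrr; exact: (is_ideal0 hJ).
- by exists (- 'X); rewrite rmorphN /= /gl1_lift bievalX opprK addrC.
- by exists 'X%:P; rewrite /gl1_lift bievalXC -opprB; exact: (is_idealN hJ).
Qed.

(** Evaluation at the generic point: the matrix alpha + beta i over the fraction field of
    O[alpha, beta] is invertible, and evaluation there kills [J1] and sends [gl1_lift F] to F. *)
Lemma gl1_lift_inj F : J1 (gl1_lift F) -> F = 0.
Proof.
move=> hF; pose K := {fraction {poly {poly O}}}.
pose s : {rmorphism O -> K} := @tofrac {poly {poly O}} \o polyC \o polyC.
pose g : 'M[K]_2 := gl1mx (tofrac 'X%:P) (tofrac 'X).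
have g_unit : \det g \is a GRing.unit.
  rewrite unitfE det_mx22 !mxE /= mulrN opprK -!rmorphM -rmorphD tofrac_eq0.
  by rewrite addrC -!expr2; exact: norm_poly_neq0.
have [f [fs fx]] := coordGL_eval s g_unit.
have fX i j : f (X i j) = g i j by rewrite -fx [RHS]mxE.
have : J1 `<=` [set r | f r = 0].
  apply: GL1c_ideal_sub; first exact: is_ideal_ker.
  - by rewrite /= rmorphD !fX !mxE /= subrr.
  - by rewrite /= rmorphB !fX !mxE /= subrr.
move=> /(_ _ hF) /=; rewrite (rmorph_bieval _ _ _ fs) !fX !mxE /= => e.
apply/eqP; rewrite -tofrac_eq0 -e; apply/eqP.
by apply: (bieval_unique (g := @tofrac {poly {poly O}})).
Qed.

(** * p-torsion freeness of the coordinate rings of GL_1^c and U_1^c *)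

Section Saturation.
Variable p : nat.
Hypothesis p_neq0 : p%:R != 0 :> O.

Let pP : p%:R = (p%:R)%:P :> {poly {poly O}}.
Proof. by rewrite rmorph_nat. Qed.

Let pP_neq0 : p%:R != 0 :> {poly {poly O}}.
Proof. by rewrite pP polyC_eq0 -(rmorph_nat polyC) polyC_eq0. Qed.

(** After clearing denominators the relation lives in the domain O[alpha, beta], where p is not
    zero. *)
Lemma GL1c_saturated (r : R) : J1 (p%:R * r) -> J1 r.
Proof.
move=> hr; have [k [F hF]] := gl1_lift_surj r; have hJ := GL1c_is_ideal.
apply: (is_ideal_det (k := k) hJ).
suff F0 : F = 0 by rewrite F0 rmorph0 subr0 in hF.
have : p%:R * F = 0.
  apply: gl1_lift_inj; rewrite rmorphM rmorph_nat.
  have -> : p%:R * gl1_lift F =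
     p%:R * r * D ^+ k - p%:R * (r * D ^+ k - gl1_lift F).
    by rewrite mulrBr mulrA subKr.
  by apply: (is_idealB hJ); [exact: (is_idealMr hJ)|exact: (is_idealMl hJ)].
by move/eqP; rewrite mulf_eq0 (negPf pP_neq0) => /eqP.
Qed.

(** With N the norm, p r in [J2] becomes (N - 1) N^k H = p N^l F in O[alpha, beta]. As N - 1 is
    monic in beta, p divides N^k H, so N^l F is a multiple of N - 1, which vanishes on U_1^c. *)
Lemma U1c_saturated (r : R) : J2 (p%:R * r) -> J2 r.
Proof.
move=> /U1c_idealP[h hh]; have hJ := GL1c_is_ideal; have hJ2 := U1c_is_ideal.
have [k [F hF]] := gl1_lift_surj r; have [l [H hH]] := gl1_lift_surj h.
have hN := gl1_lift_norm.
pose N := norm_poly O.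
have e : (N - 1) * (N ^+ k * H) = p%:R * (N ^+ l * F).
  apply/eqP; rewrite -subr_eq0; apply/eqP; apply: gl1_lift_inj.
  rewrite rmorphB !rmorphM rmorphB rmorph1 rmorph_nat !rmorphXn.
  have ring_id (S : comPzRingType) (a b c q t u : S) :
    [/\ (a - 1) * (b * (t * c)) = b * c * ((a - 1) * t)
      & b * c * (q * u) = q * (c * (u * b))] by split; ring.
  apply: (is_idealB_trans hJ (b := (D - 1) * (D ^+ k * (h * D ^+ l)))).
    apply: (is_idealBM hJ).
      by rewrite opprB addrA subrK.
    by apply: (is_idealBM hJ); [exact: (is_idealBX hJ)|exact: (is_idealBC hJ)].
  rewrite (ring_id _ _ _ _ 0 _ 0).1.
  apply: (is_idealB_trans hJ (b := D ^+ k * D ^+ l * (p%:R * r))).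
    by apply: (is_idealBMl hJ); exact: (is_idealBC hJ).
  rewrite (ring_id _ 0 _ _ _ 0 _).2; apply: (is_idealBMl hJ).
  by apply: (is_idealBM hJ) => //; apply: (is_idealBX hJ) => //; exact: (is_idealBC hJ).
have [H' eH] : exists H', N ^+ k * H = (p%:R)%:P * H'.
  by apply: monic_mulC_factor (norm_poly_monic 1) _; rewrite e pP.
have e2 : N ^+ l * F = (N - 1) * H'.
  apply: (mulfI pP_neq0); rewrite -e eH pP; exact: mulrCA.
apply: (is_ideal_det (k := k) hJ2); apply: (is_ideal_det (k := l) hJ2).
have sub12 := @GL1c_sub_U1c.
apply: (is_idealB_mem hJ2 (b := gl1_lift N ^+ l * gl1_lift F)).
  rewrite mulrC; apply: (is_idealBM hJ2); last exact: sub12.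
  by apply: (is_idealBX hJ2) => //; apply: (is_idealBC hJ2) => //; exact: sub12.
rewrite -rmorphXn -rmorphM e2 rmorphM rmorphB rmorph1; apply: (is_idealMr hJ2) => //.
apply: (is_idealB_mem hJ2 (b := D - 1)); last exact: U1c_det.
by rewrite opprB addrA subrK; exact: sub12.
Qed.

End Saturation.
End GL1c.

(** * Metric connections *)

Section Similitude.
Variables (S : comPzRingType) (I : set S) (M : 'M[S]_2).
Hypothesis I_ideal : is_ideal I.
Local Notation hI := I_ideal.

(** Modulo I the matrix commutes with [cmx], so that its transpose is its adjugate. *)
Lemma conformal_gram : I (M 0 1 + M 1 0) -> I (M 0 0 - M 1 1) ->
  [/\ I ((M^T *m M) 0 0 - \det M), I ((M^T *m M) 0 1)
    & I ((M^T *m M) 1 1 - \det M)].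
Proof.
rewrite !mxE !sum_ord2 !mxE det_mx22.
move: (M 0 0) (M 0 1) (M 1 0) (M 1 1) => a b c e hb ha; split.
- have -> : a * a + c * c - (a * e - b * c) = a * (a - e) + c * (b + c) by ring.
  by apply: (is_idealD hI); exact: (is_idealMl hI).
- have -> : a * b + c * e = b * (a - e) + e * (b + c) by ring.
  by apply: (is_idealD hI); exact: (is_idealMl hI).
- have -> : b * b + e * e - (a * e - b * c) = b * (b + c) - e * (a - e) by ring.
  by apply: (is_idealB hI); exact: (is_idealMl hI).
Qed.

(* If M^T M = m then (det M) M^T = m adj(M), which compares the entries of M
   with those of a matrix commuting with [cmx]. *)
Lemma gram_conformal m : I ((M^T *m M) 0 0 - m) -> I ((M^T *m M) 0 1) ->
    I ((M^T *m M) 1 1 - m) ->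
  I ((\det M + m) * (M 0 1 + M 1 0)) /\ I ((\det M + m) * (M 0 0 - M 1 1)).
Proof.
rewrite !mxE !sum_ord2 !mxE det_mx22.
move: (M 0 0) (M 0 1) (M 1 0) (M 1 1) => a b c e h00 h01 h11; split.
- have -> : (a * e - b * c + m) * (b + c) =
      (a + e) * (a * b + c * e) - b * (a * a + c * c - m)
      - c * (b * b + e * e - m) by ring.
  apply: (is_idealB hI); [apply: (is_idealB hI)|]; exact: (is_idealMl hI).
- have -> : (a * e - b * c + m) * (a - e) =
      (b - c) * (a * b + c * e) + e * (a * a + c * c - m)
      - a * (b * b + e * e - m) by ring.
  apply: (is_idealB hI); [apply: (is_idealD hI)|]; exact: (is_idealMl hI).
Qed.

End Similitude.

Section CompleteDVR.
Variables (p : nat) (O : idomainType).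
Hypothesis O_dvr : complete_dvr p O.

Lemma dvr_p_nonunit : (p%:R : O) \isn't a GRing.unit.
Proof.
by apply/(cdvr_nonunits O_dvr); exists 1; rewrite mulr1 expr1.
Qed.

Lemma dvr_unit1p w : (1 + p%:R * w : O) \is a GRing.unit.
Proof.
apply: contraT => /(cdvr_nonunits O_dvr)[b]; rewrite expr1 => e.
have := dvr_p_nonunit; rewrite (_ : _ \is a GRing.unit) //.
by apply/unitrP; exists (b - w); rewrite mulrC mulrBr -e addrK.
Qed.

Lemma dvr_ptorsion_free : @ptorsion_free p O.
Proof.
move=> a /eqP; rewrite mulf_eq0 (negPf (cdvr_unif_neq0 O_dvr)) => /eqP//.
Qed.

End CompleteDVR.

HB.instance Definition _ p O n := GRing.RMorphism.on (@GLhat_const p O n).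

Section Metric.
Variables (p : nat) (p_prime : prime p) (p_odd : odd p) (O : idomainType).
Variables (O_dvr : complete_dvr p O) (delta : pderivation p O).
Local Notation R := (coordGL O 2).
Local Notation Rhat := (completion p R).
Local Notation X := (coordGL_x O 2).
Local Notation x := (GLhat_x p O 2).
Local Notation cst := (@GLhat_const p O 2).
Local Notation tc := (@to_completion p R).
Local Notation J1 := (@GL1c_ideal O).
Local Notation J2 := (@U1c_ideal O).
Local Notation I1 := (@completed_ideal p O 2 J1).
Local Notation I2 := (@completed_ideal p O 2 J2).

Lemma GLhat_xE i j : x i j = tc (X i j).
Proof. exact: mxE. Qed.

Lemma GLhat_identity_eval (f : {rmorphism R -> O}) :
  (forall a, f (coordGL_const 2 a) = a) -> map_mx f X = 1%:M ->
  exists fh : {rmorphism Rhat -> O}, [/\ forall r, fh (tc r) = f r,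
    forall a, fh (cst a) = a & map_mx fh x = 1%:M].
Proof.
move=> fc fx; have [fh fhE] := completion_extension f (cdvr_complete O_dvr).
exists fh; split=> // [a|]; first by rewrite fhE fc.
by rewrite -fx; apply/matrixP => i j; rewrite !mxE fhE.
Qed.

Variables (d : O) (d_unit : d \is a GRing.unit) (D : pderivation p Rhat).
Hypothesis D_conn : is_connection delta D.
Hypothesis D_metric : is_metric delta d%:M D.
Local Notation phi := (pder_frob delta).
Local Notation Phi := (map_mx (pder_frob D) x).

Lemma connection_frob a : pder_frob D (cst a) = cst (phi a).
Proof.
by rewrite !pder_frobE D_conn [RHS]rmorphD rmorphM rmorphXn rmorph_nat.
Qed.

Let phid_unit : phi d \is a GRing.unit.
Proof. exact: rmorph_unit. Qed.

Definition metric_scale : O := d ^+ p / phi d.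
Local Notation eps := metric_scale.

Lemma metric_scaleE : eps = 1 - p%:R * (delta d / phi d).
Proof.
have e : d ^+ p = phi d - p%:R * delta d by rewrite pder_frobE addrK.
by rewrite /metric_scale {1}e mulrBl mulrV // mulrA.
Qed.

Lemma metric_scale_eq1 : eps = 1 <-> delta d = 0.
Proof.
rewrite metric_scaleE; split=> [|->]; last by rewrite mul0r mulr0 subr0.
move/eqP; rewrite eq_sym -subr_eq0 subKr mulf_eq0.
rewrite (negPf (cdvr_unif_neq0 O_dvr)) mulf_eq0 invr_eq0.
by rewrite [phi d == 0](contraTF _ phid_unit) ?orbF => [/eqP//|/eqP->]; rewrite unitr0.
Qed.

(** Apply the metric identity to x_ij. As H turns x into d x^t x, one side is phi(d) times the Gram
    entry of Phi, the other d^(p+1) / d times the p-th power of (x^t x)_ij. *)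
Lemma metric_gram i j :
  (Phi^T *m Phi) i j = cst eps * ((x^T *m x) i j) ^+ p.
Proof.
have [H [D0 [[Hc Hx] [_ D0x] e]]] := D_metric.
have Hij : H (x i j) = cst d * (x^T *m x) i j.
  have := congr1 (fun M : 'M_2 => M i j) Hx; rewrite [LHS]mxE => ->.
  by rewrite map_scalar_mx mul_mx_scalar -scalemxAl mxE.
have := e (x i j); rewrite /= Hij.
have -> : pder_frob D0 (x i j) = x i j ^+ p.
  by have := congr1 (fun M : 'M_2 => M i j) D0x; rewrite [LHS]mxE [RHS]mxE.
rewrite rmorphXn /= Hij rmorphM /= connection_frob exprMn -rmorphXn /=.
have -> : pder_frob D ((x^T *m x) i j) = (Phi^T *m Phi) i j.
  by rewrite !mxE rmorph_sum; apply: eq_bigr => k _; rewrite rmorphM !mxE.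
move=> e2; have : cst (phi d)^-1 * (cst (phi d) * (Phi^T *m Phi) i j)
   = cst (phi d)^-1 * (cst (d ^+ p) * ((x^T *m x) i j) ^+ p) by rewrite e2.
rewrite !mulrA -!rmorphM /= mulVr // rmorph1 mul1r => ->.
by rewrite /metric_scale [X in cst X]mulrC.
Qed.

Lemma GLhat_det : \det x = tc (\det X).
Proof. exact: det_map_mx. Qed.

Let tfO := cdvr_unif_neq0 O_dvr.
Let hJ1 := @GL1c_is_ideal O.
Let hJ2 := @U1c_is_ideal O.
Let hI1 : is_ideal I1 := completed_ideal_ideal tfO hJ1.
Let hI2 : is_ideal I2 := completed_ideal_ideal tfO hJ2.

Lemma GL1c_frob_gram : [/\ I1 ((Phi^T *m Phi) 0 0 - cst eps * (\det x) ^+ p),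
  I1 ((Phi^T *m Phi) 0 1) & I1 ((Phi^T *m Phi) 1 1 - cst eps * (\det x) ^+ p)].
Proof.
have [hb ha] := GL1c_ideal_gens O.
have [] := @conformal_gram _ I1 x hI1.
- by rewrite !GLhat_xE -rmorphD; exact: (to_completion_ideal _ hb).
- by rewrite !GLhat_xE -rmorphB; exact: (to_completion_ideal _ ha).
move=> h00 h01 h11; split.
- rewrite [X in I1 (X - _)]metric_gram.
  by apply: (is_idealBMl hI1); exact: (is_idealBX hI1).
- rewrite [X in I1 X]metric_gram.
  by apply: (is_idealMl hI1); apply: (is_idealX hI1) => //; exact: prime_gt0.
- rewrite [X in I1 (X - _)]metric_gram.
  by apply: (is_idealBMl hI1); exact: (is_idealBX hI1).
Qed.

Lemma GL1c_frob : I1 (Phi 0 1 + Phi 1 0) /\ I1 (Phi 0 0 - Phi 1 1).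
Proof.
have [h00 h01 h11] := GL1c_frob_gram.
have [hb ha] := gram_conformal hI1 h00 h01 h11.
have [u hu] := det_coordGL_x_inv O 2.
(* As p is odd, (p+1)/2 inverts 2 modulo p, and u inverts det x; so v inverts det Phi + m = 2 (det
   x)^p modulo p. *)
pose v : Rhat := (p.+1)./2%:R * tc u ^+ p.
have half : (p.+1)./2%:R * 2%:R = 1 + p%:R :> Rhat.
  by rewrite -natrM muln2 even_halfK /= ?negbK // -natr1 addrC.
have [w hw] : exists w, (\det Phi + cst eps * (\det x) ^+ p) * v = 1 + p%:R * w.
  rewrite det_map_mx pder_frobE metric_scaleE rmorphB rmorph1 rmorphM rmorph_nat.
  have e1 : (\det x) ^+ p * tc u ^+ p = 1.
    by rewrite -exprMn GLhat_det -rmorphM mulrC hu rmorph1 expr1n.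
  rewrite /=; move: (D (\det x)) (cst (delta d / phi d)) => g k.
  exists (1 + v * (g - k * (\det x) ^+ p)); rewrite /v.
  move: (\det x ^+ p) (tc u ^+ p) ((p.+1)./2%:R) (p%:R) e1 half.
  move=> y z h q e1 half.
  have ring_id (S : comPzRingType) (g' k' y' z' h' q' : S) :
      (y' + q' * g' + (1 - q' * k') * y') * (h' * z') =
      h' * 2%:R * (y' * z') + q' * (h' * z' * (g' - k' * y')) by ring.
  by rewrite ring_id e1 half mulr1 [in RHS]mulrDr mulr1 addrA.
by split; apply: (completed_ideal_unit tfO hJ1 hw).
Qed.

Lemma GL1c_frob_ideal r : J1 r -> I1 (pder_frob D (tc r)).
Proof.
have PhiE i j : Phi i j = pder_frob D (tc (X i j)) by rewrite mxE GLhat_xE.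
have [] := GL1c_frob; rewrite !PhiE -!rmorphD -!rmorphB => hb ha.
move: r; apply: (GL1c_ideal_sub (J := tc @^-1` (pder_frob D @^-1` I1))) => //.
by do 2![apply: ideal_preim].
Qed.

Lemma GL1c_horizontal : horizontal D J1.
Proof.
apply: (frob_horizontal tfO hJ1); first exact: GL1c_saturated.
exact: GL1c_frob_ideal.
Qed.

(** On GL_1^c the first Gram entry of Phi is both det Phi and eps (det x)^p, and det x = 1 on
    U_1^c. *)
Lemma U1c_frob_det : I2 (pder_frob D (tc (\det X - 1)) - (cst eps - 1)).
Proof.
have sub12 : I1 `<=` I2 := completed_ideal_sub (@GL1c_sub_U1c O).
have [hb ha] := GL1c_frob; have [h _ _] := conformal_gram hI1 hb ha.
have [h' _ _] := GL1c_frob_gram.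
have e1 : I2 (\det Phi - cst eps * \det x ^+ p).
  by apply: sub12; apply: (is_idealB_trans hI1) h'; exact: (is_idealBC hI1).
have e2 : I2 (\det x - 1).
  by rewrite GLhat_det -(rmorph1 tc) -rmorphB; apply: to_completion_ideal; exact: U1c_det.
have e3 : I2 (cst eps * \det x ^+ p - cst eps * 1).
  by apply: (is_idealBMl hI2); rewrite -(expr1n _ p); exact: (is_idealBX hI2).
have -> : pder_frob D (tc (\det X - 1)) = \det Phi - 1.
  by rewrite [\det Phi]det_map_mx GLhat_det [tc _]rmorphB rmorphB !rmorph1.
rewrite opprB addrA subrK.
by rewrite -[cst eps]mulr1; exact: (is_idealB_trans hI2) e1 e3.
Qed.

(** Horizontality puts the constant eps - 1 into the completed ideal, and evaluation at the
    identity, a point of U_1^c, gives eps = 1. Conversely, eps = 1 makes the Frobenius lift preserve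
    the equation det x = 1. *)
Lemma U1c_horizontal : horizontal D J2 <-> delta d = 0.
Proof.
rewrite -metric_scale_eq1; split=> [hD|e1].
  have g1 : \det (1%:M : 'M[O]_2) \is a GRing.unit by rewrite det1 unitr1.
  have [f [fc fx]] := coordGL_eval idfun g1.
  have [fh [fhE fhc fhx]] := GLhat_identity_eval fc fx.
  have fJ : forall r, J2 r -> f r = 0.
    apply: (ideal_gen_sub (J := [set r | f r = 0])); first exact: is_ideal_ker.
    move=> r [/(GL1c_ker fx)//|->] /=.
    by rewrite rmorphB rmorph1 -det_map_mx fx det1 subrr.
  have h : I2 (cst eps - 1).
    apply: (is_idealB_mem hI2 (b := pder_frob D (tc (\det X - 1)))).
      by apply: (is_idealBC hI2); exact: U1c_frob_det.
    apply: (horizontal_frob tfO hJ2 hD); apply: to_completion_ideal; exact: U1c_det.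
  have := completed_ideal_eval (cdvr_complete O_dvr) fhE fJ h.
  by rewrite rmorphB rmorph1 fhc => /eqP; rewrite subr_eq0 => /eqP.
apply: (frob_horizontal tfO hJ2); first exact: U1c_saturated.
apply: (ideal_gen_sub (J := tc @^-1` (pder_frob D @^-1` I2))).
  by do 2![apply: ideal_preim].
move=> r [hr|->].
  apply: (completed_ideal_sub (@GL1c_sub_U1c O)); exact: GL1c_frob_ideal.
apply: (is_idealB_mem hI2 U1c_frob_det); rewrite e1 rmorph1 subrr.
exact: (is_ideal0 hI2).
Qed.

End Metric.

(** * Zariski density of the values at the identity *)

Lemma gl1mxM (R : comPzRingType) (a b a' b' : R) :
  gl1mx a b *m gl1mx a' b' = gl1mx (a * a' - b * b') (a * b' + b * a').
Proof.
apply/matrixP; apply: forall_ord2; apply: forall_ord2;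
  by rewrite !mxE sum_ord2 !mxE /=; ring.
Qed.

Lemma gl1mx10 (R : pzRingType) : gl1mx 1 0 = 1%:M :> 'M[R]_2.
Proof.
by apply/matrixP; apply: forall_ord2; apply: forall_ord2; rewrite !mxE //= oppr0.
Qed.

Lemma poly_infinite_roots (A : idomainType) (Q : {poly A}) (u : nat -> A) :
  injective u -> (forall n, Q.[u n] = 0) -> Q = 0.
Proof.
move=> u_inj Qu; apply: contraTeq isT => Q0.
have := max_poly_roots (rs := [seq u n | n <- iota 0 (size Q)]) Q0.
rewrite size_map size_iota ltnn; apply; last by rewrite map_inj_uniq ?iota_uniq.
by apply/allP => _ /mapP[n _ ->]; apply/eqP.
Qed.

Lemma nat_inj_lt (T : Type) (u : nat -> T) :
  (forall i j, (i < j)%N -> u i <> u j) -> injective u.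
Proof. by move=> h i j e; case: (ltngtP i j) => // /h; rewrite e. Qed.

(** * Characteristic zero, and injectivity of the Frobenius lift of O *)

Section DVRMore.
Variables (p : nat) (p_prime : prime p) (O : idomainType).
Hypothesis O_dvr : complete_dvr p O.

(** Factors p are split off by induction; for n prime to p, a Bezout relation u n = 1 + v p makes n
    divide a unit. *)
Lemma dvr_natr_neq0 n : (0 < n)%N -> n%:R != 0 :> O.
Proof.
have [k] := ubnP n; elim: k n => // k IH n le_nk n_gt0.
have [/dvdnP[m en]|pn] := boolP (p %| n)%N.
  have m_gt0 : (0 < m)%N by move: n_gt0; rewrite en muln_gt0 => /andP[].
  rewrite en natrM mulf_neq0 ?(cdvr_unif_neq0 O_dvr) // IH //.
  rewrite -ltnS (leq_trans _ le_nk) // ltnS en -[X in (X < _)%N]muln1.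
  by rewrite ltn_pmul2l ?prime_gt1.
have : coprime n p by rewrite coprime_sym prime_coprime.
case/(coprimeP _ n_gt0) => -[u v] /= e; apply/eqP => n0.
have e2 : (u * n = 1 + v * p)%N.
  by rewrite -e subnK // ltnW // -subn_gt0 e.
have := dvr_unit1p O_dvr v%:R.
by rewrite mulrC -natrM -[1]/(1%:R) -natrD -e2 natrM n0 mulr0 unitr0.
Qed.

Lemma dvr_intr_inj : injective (fun z : int => z%:~R : O).
Proof.
suff h (z : int) : z%:~R = 0 :> O -> z = 0.
  move=> y z e; apply/eqP; rewrite -subr_eq0; apply/eqP/h.
  by rewrite rmorphB /= e subrr.
case: (intP z) => [//|n|n]; rewrite ?rmorphN /= => /eqP.
  by rewrite -pmulrn (negPf (dvr_natr_neq0 _)).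
by rewrite oppr_eq0 -pmulrn (negPf (dvr_natr_neq0 _)).
Qed.

(** An element of the kernel is no unit, hence equals p c with c again in the kernel; it is
    therefore divisible by all powers of p. *)
Lemma dvr_frob_inj (delta : pderivation p O) : injective (pder_frob delta).
Proof.
apply: raddf_inj => a; suff h m : forall a,
    pder_frob delta a = 0 -> pdivides p m a.
  by move=> fa; apply: (cdvr_complete O_dvr).1 => m; exact: h.
elim: m => [b _|m IH b fb]; first by exists b; rewrite expr0 mul1r.
have /(cdvr_nonunits O_dvr)[c ec] : b \isn't a GRing.unit.
  by apply/negP => /(rmorph_unit (pder_frob delta)); rewrite fb unitr0.
have [e ee] : pdivides p m c.
  apply: IH; apply: (dvr_ptorsion_free O_dvr).
  by rewrite -fb ec expr1 rmorphM rmorph_nat.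
by exists e; rewrite ec ee expr1 exprS mulrA.
Qed.

(** The integers embed in O, so absolute values can be compared: |d| > 1, as 0 is no unit, and p - 1
    > 0. *)
Lemma dvr_int_powers_inj (d : int) :
  (d%:~R : O) \is a GRing.unit -> d <> 1 -> d <> -1 ->
  injective (fun n => (d%:~R ^+ p.-1 : O) ^+ n).
Proof.
move=> du d1 dN1 i j; rewrite -!exprM -!rmorphXn => /dvr_intr_inj.
move=> /(congr1 absz); rewrite !abszX => /eqP.
have d_gt1 : (1 < `|d|)%N.
  case: d du d1 dN1 => [[|[|n]]|[|n]] //= du d1 dN1.
  by move: du; rewrite unitr0.
rewrite eqn_exp2l // eqn_pmul2l => [/eqP//|].
by rewrite -subn1 subn_gt0 prime_gt1.
Qed.

End DVRMore.

(* The zeros of F include the points (a, t a), for infinitely many slopes t and,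
   for each of them, infinitely many a. *)
Lemma bieval_zero (A : idomainType) (s : {rmorphism A -> A})
    (F : {poly {poly A}}) (eps : A) (t r : nat -> A) :
  injective s -> injective (fun n => eps ^+ n) -> injective t ->
  (forall e, r e != 0) ->
  (forall e n, bieval s (eps ^+ n * r e) (eps ^+ n * r e * t e) F = 0) -> F = 0.
Proof.
move=> s_inj eps_inj t_inj r0 F0.
pose sP : {rmorphism A -> {poly A}} := @polyC A \o s.
(* On the line beta = t alpha, F becomes a polynomial in alpha with the roots [eps ^+ n * r e]. *)
have line e : bieval sP 'X ('X * (t e)%:P) F = 0.
  apply: (@poly_infinite_roots _ _ (fun n => eps ^+ n * r e)).
    by move=> i j /(mulIf (r0 e)) /eps_inj.
  move=> n; rewrite -[RHS](F0 e n).
  rewrite -[LHS]/(horner_eval (eps ^+ n * r e) _).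
  rewrite (rmorph_bieval (t := s)) => [|a]; last by rewrite /= /horner_eval hornerC.
  by rewrite /= /horner_eval hornerM hornerX hornerC.
have inE q : bieval_in sP 'X q = map_poly s q.
  elim/poly_ind: q => [|q c IH]; first by rewrite !rmorph0.
  rewrite !rmorphD !rmorphM /= IH /bieval_in horner_morphX horner_morphC.
  by rewrite map_polyX map_polyC.
have in_inj : injective (bieval_in sP 'X).
  by move=> q q'; rewrite !inE; apply: map_inj_poly => //; rewrite rmorph0.
(* With s applied to its coefficients, F is a polynomial in beta over A[alpha] with the infinitely
   many roots ['X * (t e)%:P]. *)
apply: (map_inj_poly in_inj); first by rewrite rmorph0.
rewrite rmorph0; apply: (@poly_infinite_roots _ _ (fun e => 'X * (t e)%:P)) line.
by move=> i j /(mulfI (monic_neq0 (monicX A))) /polyC_inj /t_inj.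
Qed.

(* Multiplication by n on slopes: (1 + t i)^n = (1 + O(t^2)) + (n t + O(t^3)) i. *)
Lemma gl1mx_pow (R : comPzRingType) (P : set 'M[R]_2) (r t : R) n :
  P 1%:M -> (forall g h, P g -> P h -> P (g *m h)) -> P (gl1mx r (r * t)) ->
  exists a b, P (gl1mx (r ^+ n * (1 + t ^+ 2 * a))
                       (r ^+ n * t * (n%:R + t ^+ 2 * b))).
Proof.
move=> P1 PM Pr; elim: n => [|n [a [b IH]]].
  by exists 0, 0; rewrite !mulr0 !addr0 mulr0 mulr1 expr0 gl1mx10.
exists (a - n%:R - t ^+ 2 * b), (b + a).
have := PM _ _ IH Pr; rewrite gl1mxM -natr1 (exprS r).
by congr (P (gl1mx _ _)); ring.
Qed.

(** * Points of infinitely many slopes *)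

Section Slopes.
Variables (p : nat) (O : idomainType).
Hypothesis O_dvr : complete_dvr p O.
Variables (P : set 'M[O]_2) (r k : O).
Hypothesis P1 : P 1%:M.
Hypothesis PM : forall g h, P g -> P h -> P (g *m h).
Hypothesis r_unit : r \is a GRing.unit.
Hypothesis Pr : P (gl1mx r (r * (p%:R * k))).

(** Iterated p-th powers of the given point: by [gl1mx_pow] each of them multiplies the slope by p
    times a unit. *)
Lemma slopes_exist e : exists a w, [/\ a \is a GRing.unit, w \is a GRing.unit &
  P (gl1mx a (a * (p%:R ^+ e * w * (p%:R * k))))].
Proof.
elim: e => [|e [a [w [ua uw Pa]]]].
  by exists r, 1; split; rewrite ?unitr1 // expr0 !mul1r.
have [b [c]] := gl1mx_pow p P1 PM Pa.
set t := p%:R ^+ e * w * (p%:R * k); pose t' := p%:R ^+ e * w * k.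
have et : t = p%:R * t' by rewrite /t /t' mulrCA.
have ub : (1 + t ^+ 2 * b) \is a GRing.unit.
  rewrite et exprMn expr2 -!mulrA; exact: dvr_unit1p.
(* As p^2 divides t^2, a single factor p splits off from p + t^2 c and leaves y = 1 mod p. *)
pose y := 1 + p%:R * (t' ^+ 2 * c).
have uy : y \is a GRing.unit by exact: dvr_unit1p.
have ec : p%:R + t ^+ 2 * c = p%:R * y by rewrite et /y; ring.
rewrite ec => Pn.
exists (a ^+ p * (1 + t ^+ 2 * b)), (w * y / (1 + t ^+ 2 * b)); split.
- by rewrite unitrM unitrX.
- by rewrite !unitrM uw uy unitrV.
rewrite (_ : _ * (_ ^+ e.+1 * _ * _) = a ^+ p * t * (p%:R * y)) //.
have ring_id (A z i q q' w' y' l : O) :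
  A * z * (q * q' * (w' * y' * i) * l) = z * i * (A * (q' * w' * l) * (q * y')).
  by ring.
by rewrite (exprS _ e) ring_id mulrV // mul1r.
Qed.

(** The valuations grow with e: equal slopes for i < j would make p divide the unit [w i]. *)
Lemma slopes_inj (w : nat -> O) : k != 0 -> (forall e, w e \is a GRing.unit) ->
  injective (fun e => p%:R ^+ e * w e * (p%:R * k)).
Proof.
move=> k0 uw; apply: nat_inj_lt => i j lt_ij /=.
have p0 := cdvr_unif_neq0 O_dvr.
move/(mulIf (mulf_neq0 p0 k0)); rewrite -(subnKC lt_ij) addSn -addnS exprD -mulrA.
move/(mulfI (expf_neq0 i p0)) => e; have := uw i; rewrite e exprS !unitrM.
by rewrite (negPf (dvr_p_nonunit O_dvr)).
Qed.

End Slopes.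

(** * The Levi-Civita connection at the identity when d_1 = d_2 *)

Section EqualScales.
Variables (p : nat) (p_prime : prime p) (p_odd : odd p) (O : idomainType).
Variables (O_dvr : complete_dvr p O) (delta : pderivation p O).
Variables (d : O) (d_unit : d \is a GRing.unit).
Local Notation R := (coordGL O 2).
Local Notation Rhat := (completion p R).
Local Notation X := (coordGL_x O 2).
Local Notation x := (GLhat_x p O 2).
Local Notation cst := (@GLhat_const p O 2).
Local Notation tc := (@to_completion p R).
Local Notation J1 := (@GL1c_ideal O).
Local Notation phi := (pder_frob delta).
Local Notation eps := (metric_scale delta d).

Variable D : 'I_2 -> pderivation p Rhat.
Hypothesis D_conn : forall i, is_connection delta (D i).
Hypothesis D_metric : forall i, is_metric delta d%:M (D i).
Hypothesis D_sym : forall k,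
  christoffel delta d%:M (D 0) 1 k = christoffel delta d%:M (D 1) 0 k.

Variable fh : {rmorphism Rhat -> O}.
Hypothesis fh_cst : forall a, fh (cst a) = a.
Hypothesis fh_x : map_mx fh x = 1%:M.

Let p0 := cdvr_unif_neq0 O_dvr.

Let fh_xE i j : fh (x i j) = (i == j)%:R.
Proof.
have := congr1 (fun M : 'M_2 => M i j) fh_x.
by rewrite [LHS]mxE => ->; rewrite mxE.
Qed.

Let m i j k := fh (D i (x j k)).
Let h i : 'M[O]_2 := map_mx fh (map_mx (pder_frob (D i)) x).

Let hE i j k : h i j k = (j == k)%:R + p%:R * m i j k.
Proof.
rewrite [LHS]mxE [X in fh X]mxE pder_frobE rmorphD rmorphXn rmorphM rmorph_nat /= fh_xE.
by case: (j == k); rewrite ?expr1n // expr0n gtn_eqF // prime_gt0.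
Qed.

(** The identity lies on GL_1^c, so the relations of [GL1c_frob] hold for values there. *)
Let h_conformal i : h i = gl1mx (h i 0 0) (h i 0 1).
Proof.
have fh0 a : completed_ideal J1 a -> fh a = 0.
  apply: (@completed_ideal_eval _ _ _ J1 _ (fh \o tc) fh (cdvr_complete O_dvr)) => //.
  by apply: GL1c_ker; rewrite -fh_x; apply/matrixP => j k; rewrite !mxE.
have hM j k : h i j k = fh ((map_mx (pder_frob (D i)) x) j k) by rewrite [LHS]mxE.
have [] := GL1c_frob p_prime p_odd O_dvr d_unit (D_conn i) (D_metric i).
move=> /fh0; rewrite rmorphD -!hM => hb /fh0; rewrite rmorphB -!hM => ha.
apply/matrixP; apply: forall_ord2; apply: forall_ord2; rewrite [RHS]mxE //=.
- by apply/eqP; rewrite -addr_eq0 addrC hb.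
- by apply/eqP; rewrite eq_sym -subr_eq0 ha.
Qed.

Let h_gram i : (h i 0 0) ^+ 2 + (h i 0 1) ^+ 2 = eps.
Proof.
have e := metric_gram d_unit (D_conn i) (D_metric i) 0 0.
have hT : map_mx fh ((map_mx (pder_frob (D i)) x)^T *m map_mx (pder_frob (D i)) x)
   = (h i)^T *m h i by rewrite map_mxM -map_trmx.
have xT : map_mx fh (x^T *m x) = 1%:M by rewrite map_mxM -map_trmx fh_x trmx1 mulmx1.
have {e} := congr1 fh e; rewrite rmorphM fh_cst rmorphXn /=.
have -> (A : 'M[Rhat]_2) : fh (A 0 0) = map_mx fh A 0 0 by rewrite mxE.
rewrite hT [X in eps * X ^+ _](_ : _ = map_mx fh (x^T *m x) 0 0); last first.
  by rewrite [RHS]mxE.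
rewrite xT [1%:M 0 0]mxE /= expr1n mulr1 => <-.
have h10 : h i 1 0 = - h i 0 1 by rewrite {1}h_conformal mxE.
by rewrite [(_ *m _) 0 0]mxE sum_ord2 ![(h i)^T _ _]mxE h10 mulrNN !expr2.
Qed.

(** At the identity x^(p) = 1, so the Christoffel symbols are the entries of delta_i(x) times the
    common unit phi(d), which cancels. *)
Let m_sym k : m 0 k 1 = m 1 k 0.
Proof.
have := congr1 fh (D_sym k); rewrite /christoffel.
have eM i j : fh (((map_mx (D i) x)^T *m map_mx cst (map_mx phi d%:M)
   *m map_mx (fun a => a ^+ p) x) j k) = phi d * m i k j.
  rewrite !map_scalar_mx mul_mx_scalar -scalemxAl mxE rmorphM fh_cst; congr (_ * _).
  rewrite mxE rmorph_sum (bigD1 k) //= big1 => [|l lk].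
    rewrite addr0 rmorphM [X in _ * fh X]mxE rmorphXn /= fh_xE eqxx expr1n mulr1.
    by rewrite [X in fh X]mxE [X in fh X]mxE.
  rewrite rmorphM [X in _ * fh X]mxE rmorphXn /= fh_xE (negPf lk) expr0n.
  by rewrite gtn_eqF ?prime_gt0 // mulr0.
by rewrite !eM => /mulfI; apply; apply: contraTneq (rmorph_unit phi d_unit) => ->;
  rewrite unitr0.
Qed.

(** If the value of delta_0(x) is s + t i, then [m_sym] makes that of delta_1(x) equal to t - s i.
    Both 1 + p (s + t i) and 1 + p (t - s i) have norm eps, whence 2 p (s - t) = 0 and s = t. *)
Lemma identity_values : exists k, [/\ h 0 = gl1mx (1 + p%:R * k) (p%:R * k),
  h 1 = gl1mx (1 + p%:R * k) (- (p%:R * k)) &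
  (1 + p%:R * k) ^+ 2 + (p%:R * k) ^+ 2 = eps].
Proof.
exists (m 0 0 0).
have mulp_inj : injective ( *%R (p%:R : O)) by exact: mulfI.
have m11 i : m i 1 1 = m i 0 0.
  apply: mulp_inj; apply: (addrI 1); rewrite -[1](_ : (1 == 1 :> 'I_2)%:R = _) //.
  by rewrite -hE [in LHS]h_conformal mxE hE.
have m10 i : m i 1 0 = - m i 0 1.
  apply: mulp_inj; rewrite mulrN -[LHS]add0r -[X in - X]add0r.
  rewrite -[0](_ : (1 == 0 :> 'I_2)%:R = _) // -{2}[1 == 0 :> 'I_2]/(0 == 1 :> 'I_2).
  by rewrite -!hE [in LHS]h_conformal mxE.
have s0 : m 1 0 0 = m 0 0 1 by rewrite -m_sym.
have s1 : m 1 0 1 = - m 0 0 0 by rewrite -[LHS]opprK -m10 -m_sym m11.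
have two_neq0 : 2%:R != 0 :> O by exact: (dvr_natr_neq0 p_prime O_dvr).
have st : m 0 0 1 = m 0 0 0.
  have := h_gram 0; rewrite -(h_gram 1) !hE /= s0 s1 !add0r => e.
  apply: mulp_inj; apply: (mulfI two_neq0); apply/eqP; rewrite -subr_eq0; apply/eqP.
  move: (m 0 0 0) (m 0 0 1) e => s t e.
  transitivity ((1 + p%:R * t) ^+ 2 + (p%:R * - s) ^+ 2
    - ((1 + p%:R * s) ^+ 2 + (p%:R * t) ^+ 2)); first by ring.
  by rewrite e subrr.
split.
- by rewrite [LHS]h_conformal !hE /= add0r st.
- by rewrite [LHS]h_conformal !hE /= add0r s0 s1 st mulrN.
- by rewrite -(h_gram 0) !hE /= add0r st.
Qed.

Section Subgroup.
Variable J : set R.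
Hypothesis J_ideal : is_ideal J.
Hypothesis J_kill : forall r, J r -> fh (tc r) = 0.
Hypothesis J_horizontal : forall i, horizontal (D i) J.

(* The points of V(J) are taken with structure map phi : O -> O, since phi_i is
   only phi-semilinear. *)
Lemma frob_identity_points i : points J phi (h i).
Proof.
exists (fh \o (pder_frob (D i) \o tc)); split=> [a|r hr|].
- by rewrite -[RHS]fh_cst -(connection_frob (D_conn i)).
- have fE r' : fh (tc r') = (fh \o tc) r' by [].
  apply: (completed_ideal_eval (cdvr_complete O_dvr) fE J_kill).
  by apply: (horizontal_frob p0 J_ideal (J_horizontal i)); exact: to_completion_ideal.
- by apply/matrixP => j k; rewrite [LHS]mxE [X in fh X]mxE [RHS]mxE GLhat_xE.
Qed.

(** Products of [h 0] and [h 1] are already Zariski dense in GL_1^c: the polynomial F attached to an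
    element of J vanishes on all of them, and [bieval_zero] applies. *)
Lemma horizontal_subgroup_full :
  points J phi 1%:M ->
  (forall g g', points J phi g -> points J phi g' -> points J phi (g *m g')) ->
  injective (fun n => eps ^+ n) -> J1 `<=` J -> J `<=` J1.
Proof.
move=> P1 PM eps_inj sub1 r hr.
have [k [h0E h1E gram]] := identity_values.
have Ph0 : points J phi (gl1mx (1 + p%:R * k) (p%:R * k)).
  by rewrite -h0E; exact: frob_identity_points.
have Ph1 : points J phi (gl1mx (1 + p%:R * k) (- (p%:R * k))).
  by rewrite -h1E; exact: frob_identity_points.
(* The two values are conjugate, so their product is the scalar eps. *)
have Peps : points J phi (gl1mx eps 0).
  have := PM _ _ Ph0 Ph1; rewrite gl1mxM -gram.
  by congr (points J phi (gl1mx _ _)); ring.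
have PepsX n a b :
    points J phi (gl1mx a b) -> points J phi (gl1mx (eps ^+ n * a) (eps ^+ n * b)).
  move=> Pab; elim: n => [|n IH]; first by rewrite expr0 !mul1r.
  have := PM _ _ Peps IH; rewrite gl1mxM !mul0r subr0 addr0 !mulrA.
  by rewrite -exprS.
(* For k = 0 the norm relation would give eps = 1, whose powers coincide. *)
have k_neq0 : k != 0.
  apply/eqP => k0; move: gram; rewrite k0 mulr0 addr0 expr1n expr0n addr0 => e.
  by have := @eps_inj 0%N 1%N; rewrite /= -e !expr1n => /(_ erefl).
have u1 : 1 + p%:R * k \is a GRing.unit by exact: dvr_unit1p.
have Pslope : points J phi (gl1mx (1 + p%:R * k)
    ((1 + p%:R * k) * (p%:R * (k / (1 + p%:R * k))))).
  by rewrite mulrCA [_ * (k / _)]mulrC divrK.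
have sl := slopes_exist O_dvr P1 PM u1 Pslope.
pose a e := projT1 (cid (sl e)); pose w e := projT1 (cid (projT2 (cid (sl e)))).
have aw e : [/\ a e \is a GRing.unit, w e \is a GRing.unit &
    points J phi (gl1mx (a e)
      (a e * (p%:R ^+ e * w e * (p%:R * (k / (1 + p%:R * k))))))].
  exact: projT2 (cid (projT2 (cid (sl e)))).
have [l [F hF]] := gl1_lift_surj r.
suff F0 : F = 0.
  apply: (is_ideal_det (k := l) (@GL1c_is_ideal O)).
  by move: hF; rewrite F0 rmorph0 subr0.
have JF : J (gl1_lift F).
  apply: (is_idealB_mem J_ideal (b := r * \det X ^+ l)); last exact: is_idealMr.
  by apply: (is_idealBC J_ideal); exact: sub1.
apply: (bieval_zero (s := phi) (eps := eps) (r := a)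
   (t := fun e => p%:R ^+ e * w e * (p%:R * (k / (1 + p%:R * k))))).
- exact: (dvr_frob_inj O_dvr).
- exact: eps_inj.
- apply: (slopes_inj O_dvr); last by move=> e; case: (aw e).
  by rewrite mulf_neq0 // invr_neq0 //; apply: contraTneq u1 => ->; rewrite unitr0.
- by move=> e; case: (aw e) => + _ _; apply: contraTneq => ->; rewrite unitr0.
(* The point comes from a ring map f over phi that kills J; f takes [gl1_lift F] to the [bieval] of
   F at the first row of the point. *)
move=> e n; have [_ _ /(PepsX n)[f [fc fJ fx]]] := aw e.
rewrite -[RHS](fJ _ JF) (rmorph_bieval _ _ _ fc).
have fX i j : f (X i j) = (map_mx f X) i j by rewrite [RHS]mxE.
by rewrite !fX -fx !mxE /= -!mulrA.
Qed.

End Subgroup.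
End EqualScales.

(** * Horizontality of GL_1^c, of U_1^c and of the subgroups of GL_1^c *)

Theorem theorem2p20 (p : nat) (p_prime : prime p) (p_odd : odd p)
    (O : idomainType) (O_dvr : complete_dvr p O) (delta : pderivation p O)
    (d1 d2 : O) (d1_unit : d1 \is a GRing.unit) (d2_unit : d2 \is a GRing.unit)
    (D : 'I_2 -> pderivation p (completion p (coordGL O 2)))
    (D_LC : is_levi_civita delta
       (fun i : 'I_2 => if i == 0 then d1%:M else d2%:M) D) :
  [/\ forall i, horizontal (D i) (@GL1c_ideal O),
      (forall i, horizontal (D i) (@U1c_ideal O)) <->
        (delta d1 = 0 /\ delta d2 = 0) &
      forall d : int, d1 = d%:~R -> d2 = d%:~R -> d <> 1 -> d <> -1 ->
        ~ (d = 0 %[mod p])%Z ->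
        ~ exists J : set (coordGL O 2),
            [/\ is_subgroup_scheme J, @GL1c_ideal O `<=` J, J <> @GL1c_ideal O,
                spec_quotient_connected J & forall i, horizontal (D i) J]].
Proof.
case: D_LC => D_conn D_metric D_sym.
have [m0 m1] : is_metric delta d1%:M (D 0) /\ is_metric delta d2%:M (D 1).
  by split; [exact: (D_metric 0)|exact: (D_metric 1)].
split.
- apply: forall_ord2.
    exact: (GL1c_horizontal p_prime p_odd O_dvr d1_unit (D_conn 0) m0).
  exact: (GL1c_horizontal p_prime p_odd O_dvr d2_unit (D_conn 1) m1).
- rewrite -(U1c_horizontal p_prime p_odd O_dvr d1_unit (D_conn 0) m0).
  rewrite -(U1c_horizontal p_prime p_odd O_dvr d2_unit (D_conn 1) m1).
  by split=> [H|[H0 H1]]; [split|apply: forall_ord2].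
move=> d ed1 ed2 d_neq1 d_neqN1 _ [J [[J_ideal J_group] sub1 J_neq _ J_hor]].
apply: J_neq; apply/seteqP; split=> //.
(* The identity point over [idfun] supplies the evaluation that kills J; products are taken among
   points over phi. *)
have [[f [fc fJ fx]] _ _] := J_group O idfun.
have [fh [fhE fhc fhx]] := GLhat_identity_eval O_dvr fc (esym fx).
have [P1 PM _] := J_group O (pder_frob delta).
(* phi fixes integers, so d^p / phi(d) = d^(p-1). *)
have eps_pow : metric_scale (p := p) delta d1 = d%:~R ^+ p.-1.
  rewrite /metric_scale ed1 rmorph_int -{1}(prednK (prime_gt0 p_prime)) exprSr.
  by rewrite mulrK // -ed1.
apply: (@horizontal_subgroup_full p p_prime p_odd O O_dvr delta d1 d1_unit D _ _ _
  fh fhc fhx) => //.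
- by apply: forall_ord2 => //; rewrite ed1 -ed2.
- move=> k; have := D_sym 0 1 k; rewrite /= => ->.
  by rewrite ed1 -ed2.
- by move=> r /fJ; rewrite fhE.
rewrite eps_pow; apply: (dvr_int_powers_inj p_prime O_dvr) => //.
by rewrite -ed1.
Qed.
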